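(* Let $n\in\{1,2,3\}$, $\varepsilon>0$, $\lambda>0$, and let $u^0,u^1\in C^\infty(X^n)$ satisfy $D_x^2u^0+I_n\ge\lambda I_n$ and $D_x^2u^1+I_n\ge\lambda I_n$ on $X^n$. Let $u\in C^\infty(X^n\times[0,1])$ be the solution of the Donaldson equation $$u_{tt}(n+\Delta u)-\sum_{j=1}^n u_{jt}^2=\varepsilon\quad\text{on }X^n\times T,$$ with $n+\Delta u\ge0$ and Dirichlet data $u(x,0)=u^0(x)$, $u(x,1)=u^1(x)$. Then for all $(x,t)\in X^n\times T$, $$D_x^2u(x,t)+I_n>0.$$
   Context: $X^n=(\mathbf R/\mathbf Z)^n$ is the $n$-dimensional flat torus with coordinates $x=(x_1,\dots,x_n)$, and $T=(0,1)$ with coordinate $t$. $D_x^2u$ is the $n\times n$ Hessian of $u$ in the $x$ variables, $\Delta u=\sum_{j=1}^n u_{jj}$ is the Laplacian in the $x$ variables only, subscripts denote partial derivatives, and $I_n$ is the $n\times n$ identity matrix. Matrix inequalities are in the sense of symmetric matrices. For $\varepsilon>0$ it is known that the Dirichlet problem has a unique smooth solution with $n+\Delta u\ge0$. *)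

(* Defs.v *)
From HB Require Import structures.
From mathcomp Require Import all_boot all_order all_algebra.
From mathcomp Require Import all_classical all_reals all_analysis.

Set Implicit Arguments.
Unset Strict Implicit.
Unset Printing Implicit Defensive.
Import Order.TTheory GRing.Theory Num.Theory.
Import numFieldNormedType.Exports.
Local Open Scope classical_set_scope.
Local Open Scope ring_scope.

Definition iter_derive (R : realType) (V : normedModType R) (vs : seq V)
    (f : V -> R) : V -> R :=
  foldr (fun v g => 'D_v g) f vs.

(* V is meant to be finite-dimensional. The set A need not be open: as usual
   for functions smooth up to the boundary, f is smooth on A when it coincides
   there with a function that is infinitely differentiable on an open set
   containing A. The values of f outside A are irrelevant. *)
Definition smooth_on (R : realType) (V : normedModType R) (A : set V)
    (f : V -> R) : Prop :=
  exists (O : set V) (F : V -> R),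
    [/\ open O, A `<=` O,
        forall (vs : seq V) (p : V), O p -> differentiable (iter_derive vs F) p
      & forall p, A p -> F p = f p].

(* Functions on the torus (R/Z)^n are represented by their lifts to R^n. *)
Definition Zn_periodic (R : realType) (n : nat) (f : 'rV[R]_n -> R) : Prop :=
  forall (x : 'rV[R]_n) (k : 'rV[int]_n), f (x + map_mx intr k) = f x.

Definition smooth_on_torus (R : realType) (n : nat) (f : 'rV[R]_n -> R) : Prop :=
  Zn_periodic f /\ smooth_on setT f.

Definition smooth_on_torus_segment (R : realType) (n : nat)
    (u : 'rV[R]_n * R -> R) : Prop :=
  (forall t, 0 <= t <= 1 -> Zn_periodic (fun x => u (x, t))) /\
  smooth_on [set p : 'rV[R]_n * R | 0 <= p.2 <= 1] u.

Definition hessian (R : realType) (V : normedModType R) (n : nat)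
    (e : 'I_n -> V) (f : V -> R) (p : V) : 'M[R]_n :=
  \matrix_(i, j) 'D_(e i) ('D_(e j) f) p.

Definition ebase (R : realType) (n : nat) (j : 'I_n) : 'rV[R]_n := delta_mx 0 j.

Definition dx (R : realType) (n : nat) (j : 'I_n) : 'rV[R]_n * R := (ebase R j, 0).
Definition dt (R : realType) (n : nat) : 'rV[R]_n * R := (0, 1).

Definition laplacian_x (R : realType) (n : nat) (u : 'rV[R]_n * R -> R)
    (p : 'rV[R]_n * R) : R :=
  \sum_(j < n) 'D_(dx R j) ('D_(dx R j) u) p.

Definition donaldson (R : realType) (n : nat) (u : 'rV[R]_n * R -> R)
    (p : 'rV[R]_n * R) : R :=
  'D_(dt R n) ('D_(dt R n) u) p * (n%:R + laplacian_x u p)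
  - \sum_(j < n) ('D_(dt R n) ('D_(dx R j) u) p) ^+ 2.

Definition psdmx (R : realType) (n : nat) (A : 'M[R]_n) : Prop :=
  A^T = A /\ forall v : 'rV[R]_n, 0 <= (v *m A *m v^T) 0 0.

Definition pdmx (R : realType) (n : nat) (A : 'M[R]_n) : Prop :=
  A^T = A /\ forall v : 'rV[R]_n, v != 0 -> 0 < (v *m A *m v^T) 0 0.

Definition mx_le (R : realType) (n : nat) (A B : 'M[R]_n) : Prop := psdmx (B - A).
Definition mx_lt (R : realType) (n : nat) (A B : 'M[R]_n) : Prop := pdmx (B - A).

(* Main.v *)
(* Put v = u + |x|^2 / 2 and 2c = 1 - mu, where mu < 1 is a lower bound for the Hessians
   D_x^2 v at t = 0 and t = 1.  A maximum principle is applied to the N-point function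
     u(mean x_i, t) - mean u(x_i, t) - c spread(x) + delta (t^2 - t) / 2,
   in which the first three terms are nonpositive iff v - mu |x|^2 / 2 satisfies Jensen's
   inequality.  At a positive interior maximum, the second-order condition compares the
   quadratic form of D^2 (v - mu |x|^2 / 2) at the mean point with the mean of those at
   the x_i.  The latter satisfy the equation and are nonnegative in the x directions up
   to O(1/N), and the set of forms (A, b, a) with A > 0 and a (tr A + n mu) - |b|^2 <= eps
   is closed under the infimal convolution which this comparison involves; for large N
   this contradicts the presence of delta.  Placing half of the points at x + h, half at
   x - h, and letting delta tend to 0 gives the midpoint convexity of
   v - mu |x|^2 / 2 in x. *)
Require Import Defs.
From HB Require Import structures.
From mathcomp Require Import all_boot all_order all_algebra.
From mathcomp Require Import all_classical all_reals all_analysis.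
From mathcomp Require Import ring lra.
Import Order.TTheory GRing.Theory Num.Theory.
Import numFieldNormedType.Exports.
Local Open Scope ring_scope.

Set Implicit Arguments.
Unset Strict Implicit.
Unset Printing Implicit Defensive.

(** * Dot product of row vectors *)

Definition dotrv (R : realType) (m : nat) (x y : 'rV[R]_m) : R := (x *m y^T) 0 0.

Lemma dotrvE (R : realType) (m : nat) (x y : 'rV[R]_m) :
  dotrv x y = \sum_j x 0 j * y 0 j.
Proof. by rewrite /dotrv mxE; apply: eq_bigr => j _; rewrite mxE. Qed.

Lemma dotrvC (R : realType) (m : nat) (x y : 'rV[R]_m) : dotrv x y = dotrv y x.
Proof. by rewrite !dotrvE; apply: eq_bigr => j _; rewrite mulrC. Qed.

Lemma dotrvDl (R : realType) (m : nat) (x y z : 'rV[R]_m) :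
  dotrv (x + y) z = dotrv x z + dotrv y z.
Proof. by rewrite /dotrv mulmxDl mxE. Qed.

Lemma dotrvZl (R : realType) (m : nat) c (x z : 'rV[R]_m) :
  dotrv (c *: x) z = c * dotrv x z.
Proof. by rewrite /dotrv -scalemxAl mxE. Qed.

Lemma dotrvBl (R : realType) (m : nat) (x y z : 'rV[R]_m) :
  dotrv (x - y) z = dotrv x z - dotrv y z.
Proof. by rewrite dotrvDl -scaleN1r dotrvZl mulN1r. Qed.

Lemma dotrvDr (R : realType) (m : nat) (x y z : 'rV[R]_m) :
  dotrv z (x + y) = dotrv z x + dotrv z y.
Proof. by rewrite !(dotrvC z) dotrvDl. Qed.

Lemma dotrvZr (R : realType) (m : nat) c (x z : 'rV[R]_m) :
  dotrv z (c *: x) = c * dotrv z x.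
Proof. by rewrite !(dotrvC z) dotrvZl. Qed.

Lemma dotrvBr (R : realType) (m : nat) (x y z : 'rV[R]_m) :
  dotrv z (x - y) = dotrv z x - dotrv z y.
Proof. by rewrite !(dotrvC z) dotrvBl. Qed.

Lemma dotrv_ge0 (R : realType) (m : nat) (x : 'rV[R]_m) : 0 <= dotrv x x.
Proof. by rewrite dotrvE sumr_ge0 // => j _; rewrite -expr2 sqr_ge0. Qed.

Lemma dotrv_eq0 (R : realType) (m : nat) (x : 'rV[R]_m) :
  (dotrv x x == 0) = (x == 0).
Proof.
apply/idP/eqP => [|->]; last by rewrite /dotrv mul0mx mxE.
rewrite dotrvE psumr_eq0 => [/allP h|j _]; last by rewrite -expr2 sqr_ge0.
apply/rowP => j; rewrite mxE; apply/eqP.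
by have := h j (mem_index_enum _); rewrite mulf_eq0 orbb.
Qed.

Lemma dotrv_gt0 (R : realType) (m : nat) (x : 'rV[R]_m) :
  (0 < dotrv x x) = (x != 0).
Proof. by rewrite lt_neqAle dotrv_ge0 andbT eq_sym dotrv_eq0. Qed.

Lemma dotrv_CauchySchwarz (R : realType) (m : nat) (x y : 'rV[R]_m) :
  dotrv x y ^+ 2 <= dotrv x x * dotrv y y.
Proof.
have [->|x0] := eqVneq x 0; first by rewrite /dotrv !mul0mx !mxE expr0n mul0r.
have xx : 0 < dotrv x x by rewrite dotrv_gt0.
have := dotrv_ge0 (dotrv x x *: y - dotrv x y *: x).
rewrite dotrvBl !dotrvBr !dotrvZl !dotrvZr (dotrvC y x).
have -> a b c : a * (a * b) - a * (c * c) - (c * (a * c) - c * (c * a)) =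
   a * (a * b - c ^+ 2) :> R by ring.
by rewrite pmulr_rge0 // subr_ge0.
Qed.

(** * Traces of matrix products and positive definite matrices *)

Lemma outermxM (R : realType) (m : nat) (x y z w : 'rV[R]_m) :
  (x^T *m y) *m (z^T *m w) = dotrv y z *: (x^T *m w).
Proof.
rewrite mulmxA -(mulmxA _ y) [y *m z^T]mx11_scalar mul_mx_scalar.
by rewrite -scalemxAl.
Qed.

Lemma mxtrace_outer (R : realType) (m : nat) (x y : 'rV[R]_m) :
  \tr (x^T *m y) = dotrv y x.
Proof. by rewrite mxtrace_mulC [y *m _]mx11_scalar mxtrace_scalar. Qed.

Lemma mxtrace_sandwichE (R : realType) (m p : nat) (X : 'M[R]_(p, m)) (A : 'M[R]_m) :
  \tr (X *m A *m X^T) = \sum_j (row j X *m A *m (row j X)^T) 0 0.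
Proof.
apply: eq_bigr => j _; rewrite -row_mul tr_row !mxE.
by apply: eq_bigr => k _; rewrite !mxE.
Qed.

Lemma pdmx_psdmx (R : realType) (m : nat) (A : 'M[R]_m) : pdmx A -> psdmx A.
Proof.
move=> [As Ap]; split=> // v; have [->|v0] := eqVneq v 0; last exact/ltW/Ap.
by rewrite !mul0mx mxE.
Qed.

Lemma mxtrace_sandwich_ge0 (R : realType) (m p : nat) (X : 'M[R]_(p, m)) (A : 'M[R]_m) :
  psdmx A -> 0 <= \tr (X *m A *m X^T).
Proof. by move=> [_ Ap]; rewrite mxtrace_sandwichE sumr_ge0. Qed.

Lemma pdmx_unit (R : realType) (m : nat) (A : 'M[R]_m) : pdmx A -> A \in unitmx.
Proof.
move=> [_ Ap]; rewrite -row_free_unit -kermx_eq0; apply/rowV0P => v /sub_kermxP vA.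
by apply/eqP/negPn/negP => /Ap; rewrite vA mul0mx mxE ltxx.
Qed.

Lemma pdmx_inv (R : realType) (m : nat) (A : 'M[R]_m) : pdmx A -> pdmx (invmx A).
Proof.
move=> pA; have [As Ap] := pA; have uA := pdmx_unit pA.
have iAs : (invmx A)^T = invmx A by rewrite trmx_inv As.
split=> // v v0; have := Ap (v *m invmx A); rewrite mulmxKV // trmx_mul iAs mulmxA.
apply; apply: contra v0 => /eqP vA.
by rewrite -(mulmxKV uA v) vA mul0mx.
Qed.

Lemma pdmx_trace_gt0 (R : realType) (m : nat) (A : 'M[R]_m.+1) :
  pdmx A -> 0 < \tr A.
Proof.
move=> pA; have [_ Ap] := pA.
have Ad j : A j j = (ebase R j *m A *m (ebase R j)^T) 0 0.
  by rewrite /ebase -rowE trmx_delta -colE !mxE.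
rewrite /mxtrace big_ord_recl; apply: ltr_wpDr; last first.
  rewrite Ad Ap //; apply/eqP => /matrixP /(_ 0 0) /eqP.
  by rewrite !mxE !eqxx oner_eq0.
by apply: sumr_ge0 => j _; rewrite Ad; exact: (pdmx_psdmx pA).2.
Qed.

(** Acting on row vectors, this is |x||y| times the rotation taking the direction of [x] to that of
    [y] on the span of [x] and [y], and multiplication by their dot product on the orthogonal
    complement. *)
Definition rotmx (R : realType) (m : nat) (x y : 'rV[R]_m) : 'M[R]_m :=
  (dotrv x y)%:M + (x^T *m y - y^T *m x).

(* The symmetric matrix [|x|^2 |y|^2 - W W^T] is a nonnegative multiple of the
   projection onto the orthogonal complement of the span of x and y. *)
Lemma mxtrace_rotation_le (R : realType) (m : nat) (A : 'M[R]_m) (x y : 'rV[R]_m) :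
  psdmx A ->
  \tr (rotmx x y *m A *m (rotmx x y)^T) <= dotrv x x * dotrv y y * \tr A.
Proof.
move=> pA; have [As _] := pA; rewrite /rotmx; set c := dotrv x y; set K := _ - _.
pose s := dotrv x x * dotrv y y - c ^+ 2.
have s_ge0 : 0 <= s by rewrite subr_ge0 dotrv_CauchySchwarz.
have KT : K^T = - K by rewrite /K linearB /= !trmx_mul !trmxK opprB.
have K2 : K *m K = c *: (x^T *m y + y^T *m x)
    - dotrv y y *: (x^T *m x) - dotrv x x *: (y^T *m y).
  rewrite /K mulmxBl !mulmxBr !outermxM (dotrvC y x) -/c.
  by apply/matrixP => i j; rewrite !mxE; ring.
(* [K] vanishes on the complement of the span of [x] and [y] and squares to [- s] on the span, where
   [s] is the Gram determinant. *)
have K3 : K *m K *m K = - s *: K.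
  rewrite K2 /K !mulmxBl mulmxBr -!scalemxAl.
  rewrite !(mulmxDl, mulmxBl, mulmxBr, mulmxDr) !outermxM (dotrvC y x) -/c /s.
  apply/matrixP => i j.
  rewrite !mxE; ring.
clearbody K.
have WA : \tr ((c%:M + K) *m A *m (c%:M + K)^T) = c ^+ 2 * \tr A - \tr (K *m K *m A).
  rewrite raddfD /= tr_scalar_mx KT mulmxDl mul_scalar_mx mulmxDr !mulmxDl.
  rewrite !mulmxN !mul_mx_scalar -!scalemxAl !mxtraceD !raddfN /= !mxtraceZ.
  rewrite [\tr (A *m K)]mxtrace_mulC [\tr (K *m A *m K)]mxtrace_mulC mulmxA.
  by ring.
rewrite WA -subr_ge0.
have -> : dotrv x x * dotrv y y * \tr A - (c ^+ 2 * \tr A - \tr (K *m K *m A))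
  = \tr ((s%:M + K *m K) *m A).
  by rewrite mulmxDl mul_scalar_mx mxtraceD mxtraceZ /s; ring.
set S := s%:M + _.
have ST : S^T = S by rewrite /S raddfD /= tr_scalar_mx trmx_mul KT mulmxN mulNmx opprK.
have SS : S *m S = s *: S.
  rewrite {1}/S mulmxDl mul_scalar_mx -[RHS]addr0; congr (_ + _).
  by rewrite /S mulmxDr mul_mx_scalar mulmxA K3 -scalemxAl -scalerDl subrr scale0r.
have h : 0 <= s * \tr (S *m A).
  rewrite -mxtraceZ scalemxAl -SS -mulmxA mxtrace_mulC.
  by rewrite -{2}ST; exact: mxtrace_sandwich_ge0.
(* For collinear [x] and [y] division by [s] is impossible, but then [S] is symmetric with zero
   square, so its rows have zero norm. *)
have [s0|] := eqVneq s 0; last first.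
  by move=> s0; rewrite -(@pmulr_rge0 _ s) // lt_neqAle eq_sym s0.
suff -> : S = 0 by rewrite mul0mx mxtrace0.
have : \tr (S *m S^T) = 0 by rewrite ST SS s0 scale0r mxtrace0.
move=> hS; apply/row_matrixP => j; rewrite row0; apply/eqP; rewrite -dotrv_eq0.
move/eqP: hS; rewrite -[S in S *m _]mulmx1 mxtrace_sandwichE psumr_eq0.
  by move=> /allP /(_ j (mem_index_enum _)); rewrite mulmx1.
by move=> k _; rewrite mulmx1; exact: dotrv_ge0.
Qed.

(** * Legendre transforms and means of quadratic forms *)

Lemma mulmx_rotmx (R : realType) (m : nat) (x y : 'rV[R]_m) :
  x *m rotmx x y = dotrv x x *: y.
Proof.
rewrite /rotmx mulmxDr mulmxBr mul_mx_scalar !mulmxA.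
rewrite [x *m x^T]mx11_scalar [x *m y^T]mx11_scalar !mul_scalar_mx.
by rewrite addrC subrK.
Qed.

Lemma mxtrace_rotmx_sym (R : realType) (m : nat) (A : 'M[R]_m) (x y : 'rV[R]_m) :
  A^T = A -> \tr (rotmx x y *m A) = dotrv x y * \tr A.
Proof.
move=> As; rewrite /rotmx mulmxDl mul_scalar_mx mxtraceD mxtraceZ.
rewrite mulmxBl mxtraceD raddfN /= -[in X in _ - X]mxtrace_tr !trmx_mul As trmxK.
by rewrite [\tr (_ *m (x^T *m y))]mxtrace_mulC subrr addr0.
Qed.

(** Fenchel's inequality for the form tr(U A U^T): expand the nonnegative trace of Z A Z^T with Z =
    Y A^-1 - U. *)
Lemma mxtrace_sandwich_inv_ge (R : realType) (m : nat) (A Y U : 'M[R]_m) :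
  pdmx A ->
  2 * \tr (U *m Y^T) - \tr (U *m A *m U^T) <= \tr (Y *m invmx A *m Y^T).
Proof.
move=> pA; have uA := pdmx_unit pA; have [iAs _] := pdmx_inv pA.
have := mxtrace_sandwich_ge0 (Y *m invmx A - U) (pdmx_psdmx pA).
rewrite mulmxBl mulmxKV // raddfB /= trmx_mul iAs mulmxBr !mulmxBl !mulmxA.
rewrite mulmxK // !raddfB /= -[\tr (Y *m U^T)]mxtrace_tr trmx_mul trmxK; lra.
Qed.

(* Lower bound, by testing with a multiple of [rotmx x b], for the sum of the
   Legendre transforms of a quadratic form [qform A b a] with [a tr A = |b|^2]. *)
Lemma mxtrace_legendre_ge (R : realType) (m : nat) (A Ah Y : 'M[R]_m.+1)
    (x b : 'rV[R]_m.+1) (rho : R) :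
  pdmx A -> Ah^T = Ah -> \tr Ah = rho * dotrv x x ->
  Y = Ah - rho *: (x^T *m (x - b)) ->
  dotrv b b / \tr A * (rho ^+ 2 * dotrv x x) <= \tr (Y *m invmx A *m Y^T).
Proof.
move=> pA Ahs trAh YE; have tA := pdmx_trace_gt0 pA.
(* Write W for [rotmx x b] and P for |x|^2 |b|^2. Then tr(W Y^T) = rho P and tr(W A W^T) <= P tr A,
   and the factor rho / tr A maximises 2 c rho P - c^2 P tr A over c. *)
apply: le_trans (mxtrace_sandwich_inv_ge Y ((rho / \tr A) *: rotmx x b) pA).
have -> : \tr ((rho / \tr A) *: rotmx x b *m Y^T) =
    rho ^+ 2 / \tr A * (dotrv x x * dotrv b b).
  rewrite -scalemxAl mxtraceZ YE raddfB /= Ahs linearZ /= trmx_mul trmxK.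
  rewrite mulmxBr raddfB /= mxtrace_rotmx_sym // trAh -scalemxAr mxtraceZ.
  rewrite mulmxA mxtrace_mulC mulmxA mulmx_rotmx [(_ *: _) *m _]mx11_scalar.
  by rewrite mxtrace_scalar -/(dotrv _ _) dotrvZl dotrvBr (dotrvC b x); ring.
rewrite linearZ /= -!scalemxAl -scalemxAr scalerA mxtraceZ.
have := mxtrace_rotation_le x b (pdmx_psdmx pA) => h.
have r0 : 0 <= rho / \tr A * (rho / \tr A) by rewrite -expr2 sqr_ge0.
have := ler_wpM2l r0 h.
have -> : rho / \tr A * (rho / \tr A) * (dotrv x x * dotrv b b * \tr A) =
    rho ^+ 2 / \tr A * (dotrv x x * dotrv b b).
  by field; rewrite gt_eqF.
have -> : dotrv b b / \tr A * (rho ^+ 2 * dotrv x x) =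
    rho ^+ 2 / \tr A * (dotrv x x * dotrv b b) by ring.
lra.
Qed.

(** The value at (h, s) of the quadratic form whose symmetric block matrix has diagonal blocks [A]
    and [a] and off-diagonal block [b]. *)
Definition qform (R : realType) (m : nat) (A : 'M[R]_m) (b : 'rV[R]_m) (a : R)
    (h : 'rV[R]_m) (s : R) : R :=
  (h *m A *m h^T) 0 0 + 2 * s * dotrv b h + a * s ^+ 2.

Lemma qform_sum_row (R : realType) (m : nat) (A H : 'M[R]_m) (b s : 'rV[R]_m) (a : R) :
  \sum_j qform A b a (row j H) (s 0 j) =
  \tr (H *m A *m H^T) + 2 * dotrv s (b *m H^T) + a * dotrv s s.
Proof.
rewrite /qform !big_split /= mxtrace_sandwichE; congr (_ + _ + _).
  rewrite dotrvE mulr_sumr; apply: eq_bigr => j _; rewrite mulrA; congr (_ * _).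
  by rewrite /dotrv tr_row !mxE; apply: eq_bigr => k _; rewrite !mxE.
by rewrite dotrvE mulr_sumr; apply: eq_bigr => j _; rewrite expr2.
Qed.

(** The index [i0] excludes the empty sum, which is not definite in positive dimension. *)
Lemma psdmx_sum (R : realType) (m : nat) (I : finType) (A : I -> 'M[R]_m) (i0 : I) :
  (forall i, pdmx (A i)) -> pdmx (\sum_i A i).
Proof.
move=> pA; split; first by rewrite raddf_sum; apply: eq_bigr => i _; have [] := pA i.
move=> v v0; rewrite mulmx_sumr mulmx_suml summxE (bigD1 i0) //=.
by apply: ltr_wpDr; [apply: sumr_ge0 => i _; apply/ltW|]; apply: (pA _).2.
Qed.

(* The quadratic forms [qform (A i) (b i) (a i)] are tested on the rows of [H i],
   chosen so that the mean of the [H i] is the identity: only the trace of [A0] remains. *)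
Lemma qform_mean_le (R : realType) (m N : nat)
    (A : 'I_N.+1 -> 'M[R]_m.+1) (b : 'I_N.+1 -> 'rV[R]_m.+1) (a : 'I_N.+1 -> R)
    (A0 : 'M[R]_m.+1) (b0 : 'rV[R]_m.+1) (a0 : R) :
  (forall i, pdmx (A i)) ->
  (forall i, a i * \tr (A i) <= dotrv (b i) (b i)) ->
  \sum_i b i *m invmx (A i) != 0 ->
  0 < \tr A0 ->
  (forall (h : 'I_N.+1 -> 'rV[R]_m.+1) (s : R),
    qform A0 b0 a0 (N.+1%:R^-1 *: \sum_i h i) s <=
    N.+1%:R^-1 * \sum_i qform (A i) (b i) (a i) (h i) s) ->
  a0 * \tr A0 <= dotrv b0 b0.
Proof.
move=> pA aA bM0 tA0 hQ.
pose k : R := N.+1%:R^-1.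
have k0 : 0 < k by rewrite invr_gt0 ltr0n.
have kN : k * N.+1%:R = 1 by rewrite mulVf // pnatr_eq0.
pose M := \sum_i invmx (A i).
have pM : pdmx M by apply: (psdmx_sum ord0) => i; exact: pdmx_inv.
have uM := pdmx_unit pM.
(* [Ah] is the harmonic mean of the [A i], and [x] below is the mean of the [b i] weighted by the
   inverses of the [A i]. *)
pose Ah := k^-1 *: invmx M.
have Ahs : Ah^T = Ah by rewrite /Ah linearZ /= (pdmx_inv pM).1.
pose x := (\sum_i b i *m invmx (A i)) *m invmx M.
have xM : x *m M = \sum_i b i *m invmx (A i) by rewrite mulmxKV.
have x0 : x != 0 by apply: contra bM0 => /eqP x0; rewrite -xM x0 mul0mx.
have xx : 0 < dotrv x x by rewrite dotrv_gt0.
(* This value makes the trace of [Ah - rho *: (x^T *m x)] vanish, so that the bounds [hi] add up to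
   zero. *)
pose rho := \tr Ah / dotrv x x.
have trAh : \tr Ah = rho * dotrv x x by rewrite divfK ?gt_eqF.
pose Y i := Ah - rho *: (x^T *m (x - b i)).
(* Lagrange multipliers: with time component [- rho * x 0 j], the rows j of the [H i] minimise the
   mean of the forms among displacements whose mean is the j-th basis vector. *)
pose H i := Y i *m invmx (A i).
have HM : k *: \sum_i H i = 1%:M.
  have -> : \sum_i H i = Ah *m M - rho *: (x^T *m (x *m M - \sum_i b i *m invmx (A i))).
    rewrite [x *m M]mulmx_sumr -sumrB !mulmx_sumr scaler_sumr -sumrB.
    apply: eq_bigr => i _; rewrite /H /Y mulmxBl -(scalemxAl rho) -(mulmxA x^T).
    by rewrite (mulmxBl x).
  by rewrite xM subrr mulmx0 scaler0 subr0 /Ah -scalemxAl mulVmx // scalerA divff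
    ?scale1r // gt_eqF.
pose s : 'rV[R]_m.+1 := - rho *: x.
have hsum : \tr A0 + 2 * dotrv s b0 + a0 * dotrv s s <=
    k * \sum_i (\tr (H i *m A i *m (H i)^T) + 2 * dotrv s (b i *m (H i)^T)
      + a i * dotrv s s).
  have -> : \tr A0 + 2 * dotrv s b0 + a0 * dotrv s s =
      \sum_j qform A0 b0 a0 (row j 1%:M) (s 0 j).
    by rewrite qform_sum_row trmx1 !mulmx1 mul1mx.
  have -> : \sum_i (\tr (H i *m A i *m (H i)^T) + 2 * dotrv s (b i *m (H i)^T)
      + a i * dotrv s s) = \sum_i \sum_j qform (A i) (b i) (a i) (row j (H i)) (s 0 j).
    by apply: eq_bigr => i _; rewrite qform_sum_row.
  rewrite exchange_big /= mulr_sumr; apply: ler_sum => j _.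
  rewrite -HM linearZ /= raddf_sum /=.
  exact: (hQ (fun i => row j (H i))).
have hi i : \tr (H i *m A i *m (H i)^T) + 2 * dotrv s (b i *m (H i)^T)
      + a i * dotrv s s <= 2 * \tr ((Ah - rho *: (x^T *m x)) *m (H i)^T).
  have [iAs _] := pdmx_inv (pA i).
  have uA := pdmx_unit (pA i).
  have tA := pdmx_trace_gt0 (pA i).
  have hY := mxtrace_legendre_ge (pA i) Ahs trAh (erefl (Y i)).
  have haA : a i <= dotrv (b i) (b i) / \tr (A i) by rewrite ler_pdivlMr.
  have {}hY : a i * (rho ^+ 2 * dotrv x x) <= \tr (Y i *m invmx (A i) *m (Y i)^T).
    by apply: le_trans hY; apply: ler_wpM2r haA; rewrite mulr_ge0 ?sqr_ge0 ?dotrv_ge0.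
  have -> : Ah - rho *: (x^T *m x) = Y i - rho *: (x^T *m b i).
    by rewrite /Y mulmxBr; apply/matrixP => p q; rewrite !mxE; ring.
  have HT : (H i)^T = invmx (A i) *m (Y i)^T by rewrite /H trmx_mul iAs.
  have -> : \tr (H i *m A i *m (H i)^T) = \tr (Y i *m invmx (A i) *m (Y i)^T).
    by rewrite HT /H mulmxKV // mulmxA.
  have -> : \tr ((Y i - rho *: (x^T *m b i)) *m (H i)^T) =
      \tr (Y i *m invmx (A i) *m (Y i)^T) - rho * dotrv (b i *m (H i)^T) x.
    rewrite (mulmxBl (Y i)) raddfB /= -scalemxAl mxtraceZ -(mulmxA x^T) mxtrace_outer.
    by rewrite HT !mulmxA.
  rewrite /s dotrvZl dotrvZr dotrvZl (dotrvC x).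
  by move: hY; set P := \tr _; set D := dotrv _ x; nra.
have : \tr A0 + 2 * dotrv s b0 + a0 * dotrv s s <= 0.
  apply: le_trans hsum _; rewrite pmulr_rle0 //.
  apply: le_trans (ler_sum _ (fun i _ => hi i)) _.
  rewrite -mulr_sumr -raddf_sum /= -mulmx_sumr -raddf_sum /=.
  have -> : (\sum_i H i)^T = k^-1 *: 1%:M.
    by rewrite -trmx1 -HM [in RHS]linearZ /= scalerA mulVf ?scale1r ?gt_eqF.
  rewrite -scalemxAr mulmx1 mxtraceZ raddfB /= (mxtraceZ rho).
  by rewrite mxtrace_outer trAh subrr !mulr0.
rewrite /s dotrvZl dotrvZr dotrvZl => h.
(* Let Q be rho^2 |x|^2. If a0 tr A0 exceeded |b0|^2, Cauchy-Schwarz would put 4 (rho x.b0)^2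
   strictly below 4 Q a0 tr A0, which is at most (tr A0 + a0 Q)^2; this contradicts [h]. *)
rewrite leNgt; apply/negP => hlt.
have CS := dotrv_CauchySchwarz x b0.
have bb := dotrv_ge0 b0.
have a00 : 0 < a0 by rewrite -(pmulr_lgt0 _ tA0); apply: le_lt_trans hlt.
have h1 : \tr A0 + a0 * (rho ^+ 2 * dotrv x x) <= 2 * (rho * dotrv x b0) by lra.
have h2 : 0 <= a0 * (rho ^+ 2 * dotrv x x).
  by apply: mulr_ge0 (ltW a00) _; rewrite mulr_ge0 ?sqr_ge0 ?dotrv_ge0.
have h3 : (\tr A0 + a0 * (rho ^+ 2 * dotrv x x)) ^+ 2 <= (2 * (rho * dotrv x b0)) ^+ 2.
  by rewrite ler_sqr // nnegrE; lra.
have rho0 : rho != 0.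
  by apply/eqP => r0; move: h1; rewrite r0 !(mul0r, expr0n, mulr0) /=; lra.
have h4 : (rho * dotrv x b0) ^+ 2 < a0 * \tr A0 * (rho ^+ 2 * dotrv x x).
  apply: (@le_lt_trans _ _ (rho ^+ 2 * (dotrv x x * dotrv b0 b0))).
    by rewrite exprMn ler_wpM2l ?sqr_ge0.
  have := hlt; rewrite -(ltr_pM2r (_ : 0 < rho ^+ 2 * dotrv x x)); first by lra.
  by rewrite mulr_gt0 // exprn_even_gt0.
have := sqr_ge0 (\tr A0 - a0 * (rho ^+ 2 * dotrv x x)).
by move: h3 h4; set P := rho * _; set Q := rho ^+ 2 * _; nra.
Qed.

Lemma sqr_mean_le (R : realType) (N : nat) (c : 'I_N.+1 -> R) :
  (N.+1%:R^-1 * \sum_i c i) ^+ 2 <= N.+1%:R^-1 * \sum_i c i ^+ 2.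
Proof.
set k : R := _^-1; set S := \sum_i c i.
have kN : k * N.+1%:R = 1 by rewrite mulVf // pnatr_eq0.
have k0 : 0 <= k by rewrite invr_ge0.
have : 0 <= k * \sum_i (c i - k * S) ^+ 2.
  by rewrite mulr_ge0 // sumr_ge0 // => i _; exact: sqr_ge0.
have -> : \sum_i (c i - k * S) ^+ 2 =
    \sum_i c i ^+ 2 - 2 * (k * S) * S + N.+1%:R * (k * S) ^+ 2.
  have -> : \sum_i (c i - k * S) ^+ 2 =
      \sum_i (c i ^+ 2 - 2 * (k * S) * c i + (k * S) ^+ 2).
    by apply: eq_bigr => i _; ring.
  rewrite big_split sumrB -mulr_sumr sumr_const card_ord.
  by rewrite -[_ *+ N.+1]mulr_natl.
set T := \sum_i _.
have -> : k * (T - 2 * (k * S) * S + N.+1%:R * (k * S) ^+ 2) =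
  k * T - 2 * (k * S) ^+ 2 + k * N.+1%:R * (k * S) ^+ 2 by ring.
by rewrite kN; lra.
Qed.

(* An extra coordinate turns [kap] into an entry of the trace and [eps] into
   the square of an entry of the mixed derivatives. *)
Lemma qform_mean_le_shift (R : realType) (n N : nat)
    (A : 'I_N.+1 -> 'M[R]_n) (b : 'I_N.+1 -> 'rV[R]_n) (a : 'I_N.+1 -> R)
    (A0 : 'M[R]_n) (b0 : 'rV[R]_n) (a0 eps kap : R) :
  0 < eps -> 0 < kap ->
  (forall i, pdmx (A i)) ->
  (forall i, a i * (\tr (A i) + kap) <= eps + dotrv (b i) (b i)) ->
  0 < \tr A0 + kap ->
  (forall (h : 'I_N.+1 -> 'rV[R]_n) (s : R),
    qform A0 b0 a0 (N.+1%:R^-1 *: \sum_i h i) s <=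
    N.+1%:R^-1 * \sum_i qform (A i) (b i) (a i) (h i) s) ->
  a0 * (\tr A0 + kap) <= eps + dotrv b0 b0.
Proof.
move=> eps0 kap0 pA aA tA0 hQ.
pose ext (B : 'M[R]_n) : 'M[R]_n.+1 := block_mx (kap%:M : 'M[R]_1) 0 0 B.
pose extv (c : 'rV[R]_n) : 'rV[R]_n.+1 := row_mx ((Num.sqrt eps)%:M : 'M[R]_1) c.
have ext_tr B : \tr (ext B) = \tr B + kap.
  by rewrite /ext (mxtrace_block (kap%:M : 'M[R]_1)) mxtrace_scalar addrC.
have dot_row (c c' : 'M[R]_1) (d d' : 'rV[R]_n) :
    dotrv (row_mx c d : 'rV[R]_n.+1) (row_mx c' d') = c 0 0 * c' 0 0 + dotrv d d'.
  rewrite /dotrv (tr_row_mx c') (mul_row_col c) [LHS]mxE; congr (_ + _).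
  by rewrite !mxE big_ord1 !mxE.
have extv_dot c : dotrv (extv c) (extv c) = eps + dotrv c c.
  by rewrite dot_row !mxE eqxx mulr1n -expr2 sqr_sqrtr // ltW.
have ext_form B (c : 'M[R]_1) (d : 'rV[R]_n) :
    ((row_mx c d : 'rV[R]_n.+1) *m ext B *m (row_mx c d : 'rV[R]_n.+1)^T) 0 0 =
    kap * c 0 0 ^+ 2 + (d *m B *m d^T) 0 0.
  rewrite /ext (@mul_row_block R 1 1 n 1 n c d) !mulmx0 addr0 add0r -/(dotrv _ _) dot_row.
  by rewrite mul_mx_scalar [(kap *: c) 0 0]mxE /dotrv; ring.
have ext_qform B c (e : R) (h : 'rV[R]_n.+1) s :
    qform (ext B) (extv c) e h s =
    qform B c e (@rsubmx R 1 1 n h) s + (kap * h 0 0 ^+ 2 + 2 * s * Num.sqrt eps * h 0 0).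
  have hE : h = row_mx (@lsubmx R 1 1 n h) (@rsubmx R 1 1 n h) by rewrite hsubmxK.
  have h00 : h 0 0 = (@lsubmx R 1 1 n h) 0 0 by rewrite mxE lshift0.
  rewrite /qform h00 [in LHS]hE ext_form dot_row !mxE eqxx mulr1n; ring.
rewrite -ext_tr -extv_dot.
apply: (@qform_mean_le R n N (fun i => ext (A i)) (fun i => extv (b i)) a).
- move=> i; have [As Ap] := pA i; split.
    by rewrite /ext (tr_block_mx (kap%:M : 'M[R]_1)) !trmx0 tr_scalar_mx As.
  move=> v v0; have vE : v = row_mx (@lsubmx R 1 1 n v) (@rsubmx R 1 1 n v) by rewrite hsubmxK.
  rewrite vE ext_form.
  have [r0|r0] := eqVneq (@rsubmx R 1 1 n v) 0; last first.
    by apply: ltr_wpDl (Ap _ r0); rewrite mulr_ge0 ?sqr_ge0 // ltW.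
  rewrite r0 !mul0mx [X in _ + X]mxE addr0 mulr_gt0 // exprn_even_gt0 //=.
  apply: contra v0 => /eqP l0; apply/eqP; rewrite vE r0.
  by rewrite [X in row_mx X _]mx11_scalar l0 raddf0 (@row_mx0 R 1 1 n).
- by move=> i; rewrite ext_tr extv_dot.
(* The required nonvanishing is read off in the added coordinate, where each summand equals
   sqrt(eps) / kap. *)
- have pE i : ext (A i) \in unitmx.
    rewrite unitmxE /ext (@det_ublock _ 1 n) det_scalar1 unitrM -unitmxE.
    by rewrite (pdmx_unit (pA i)) andbT unitfE gt_eqF.
  have yE i : (extv (b i) *m invmx (ext (A i))) 0 0 = Num.sqrt eps / kap.
    set y := _ *m _; have : y *m ext (A i) = extv (b i) by rewrite mulmxKV.
    have {1}-> : y = row_mx (@lsubmx R 1 1 n y) (@rsubmx R 1 1 n y) by rewrite hsubmxK.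
    rewrite /ext (@mul_row_block R 1 1 n 1 n (@lsubmx R 1 1 n y) (@rsubmx R 1 1 n y)) mulmx0 addr0 mul_mx_scalar.
    move=> /(@eq_row_mx R 1 1 n _ _ _ _) [/matrixP /(_ 0 0) + _].
    rewrite !mxE eqxx mulr1n lshift0 => <-.
    by rewrite mulrAC divff ?mul1r // gt_eqF.
  apply/eqP => /matrixP /(_ 0 0) /eqP; rewrite summxE mxE.
  under eq_bigr do rewrite yE.
  rewrite sumr_const mulrn_eq0 card_ord /= gt_eqF // divr_gt0 //.
  by rewrite sqrtr_gt0.
- by rewrite ext_tr.
(* In the added coordinate the cross term is linear and the same for all the forms, so it cancels;
   the square term is handled by convexity. *)
move=> h s; rewrite ext_qform.
rewrite (eq_bigr _ (fun i _ => ext_qform (A i) (b i) (a i) (h i) s)).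
rewrite big_split mulrDr /=; apply: lerD.
  have -> : @rsubmx R 1 1 n (N.+1%:R^-1 *: \sum_i h i) =
      N.+1%:R^-1 *: \sum_i @rsubmx R 1 1 n (h i).
    by rewrite linearZ /= raddf_sum.
  exact: hQ.
rewrite mxE summxE big_split /= -!mulr_sumr mulrDr.
have := sqr_mean_le (fun i => h i 0 0); set S := \sum_i h i 0 0.
set T := \sum_i _ ^+ 2 => hS.
rewrite [_^-1 * (kap * _)]mulrCA [_^-1 * (2 * _ * _ * _)]mulrCA lerD2r.
by rewrite ler_pM2l.
Qed.

Local Open Scope classical_set_scope.
Local Open Scope ring_scope.

(** * Directional derivatives and second differences *)

Lemma is_derive_line (R : realType) (V : normedModType R) (f : V -> R) (p v : V) (r : R) :
  differentiable f (p + r *: v) ->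
  is_derive r 1 (fun t => f (p + t *: v)) ('D_v f (p + r *: v)).
Proof.
move=> df.
have E : (fun h : R => h^-1 *: (f (p + (h *: (1 : R) + r) *: v) - f (p + r *: v))) =
   (fun h : R => h^-1 *: (f (h *: v + (p + r *: v)) - f (p + r *: v))).
  apply/funext => h; congr (_ *: (f _ - _)).
  by rewrite [h *: 1]mulr1 scalerDl addrCA.
apply: DeriveDef; last by rewrite /derive; congr (lim _); rewrite -E.
have := @diff_derivable _ _ _ f (p + r *: v) v df.
by rewrite /derivable /= -E.
Qed.

Lemma MVT_from0 (R : realType) (f df : R -> R) (tau : R) :
  0 < tau -> (forall r, 0 <= r <= tau -> is_derive r 1 f (df r)) ->
  exists2 r, 0 <= r <= tau & f tau - f 0 = tau * df r.
Proof.
move=> tau0 fdf.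
have [r rI|x xI|r rI ->] := @MVT R f df 0 tau tau0.
- by apply: fdf; move: rI; rewrite in_itv /= => /andP[r0 rt]; rewrite !ltW.
- by move: x xI; apply: derivable_within_continuous => r rI; apply: ex_derive; apply: fdf;
    move: rI; rewrite in_itv.
- exists r; last by rewrite subr0 mulrC.
  by move: rI; rewrite in_itv /= => /andP[r0 rt]; rewrite !ltW.
Qed.

(** The mean value theorem is used twice: along [u] for the increment of [f] in the direction [v],
    then along [v] for ['D_u f]. *)
Lemma second_difference_mvt (R : realType) (V : normedModType R) (f : V -> R)
    (p u v : V) (tau : R) :
  0 < tau ->
  (forall a b, 0 <= a <= tau -> 0 <= b <= tau ->
     differentiable f (p + a *: u + b *: v) /\
     differentiable ('D_u f) (p + a *: u + b *: v)) ->
  exists a b, [/\ 0 <= a <= tau, 0 <= b <= tau &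
    f (p + tau *: u + tau *: v) - f (p + tau *: u) - f (p + tau *: v) + f p =
    tau ^+ 2 * 'D_v ('D_u f) (p + a *: u + b *: v)].
Proof.
move=> tau0 df.
have in0 : 0 <= (0 : R) <= tau by rewrite lexx ltW.
have int : 0 <= tau <= tau by rewrite lexx ltW.
pose g r := f (p + tau *: v + r *: u) - f (p + r *: u).
have dg r : 0 <= r <= tau -> is_derive r 1 g
    ('D_u f (p + tau *: v + r *: u) - 'D_u f (p + r *: u)).
  move=> hr; apply: is_deriveB; apply: is_derive_line.
    by rewrite addrAC; apply: (df r tau hr int).1.
  by have := (df r 0 hr in0).1; rewrite scale0r addr0.
have [a hat ha] := MVT_from0 tau0 dg.
pose k r := 'D_u f (p + a *: u + r *: v).
have dk r : 0 <= r <= tau -> is_derive r 1 k ('D_v ('D_u f) (p + a *: u + r *: v)).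
  by move=> hr; apply: is_derive_line; apply: (df a r hat hr).2.
have [b hbt hb] := MVT_from0 tau0 (fun r hr => dk r hr).
exists a, b; split => //.
move: ha hb; rewrite /g /k !scale0r !addr0 => ha hb.
transitivity (f (p + tau *: v + tau *: u) - f (p + tau *: u) - (f (p + tau *: v) - f p)).
  by rewrite (addrAC p (tau *: u)); ring.
by rewrite ha (addrAC p (tau *: v)) hb; ring.
Qed.

(** The drift [w] of the base point serves two uses: [w = 0] gives the symmetry of second
    derivatives, and [u = v], [w = - v] gives the centred second difference. *)
Lemma second_difference_cvg (R : realType) (V : normedModType R) (O : set V)
    (f : V -> R) (p u v w : V) :
  open O -> O p ->
  (forall q, O q -> differentiable f q /\ differentiable ('D_u f) q) ->
  {for p, continuous ('D_v ('D_u f))} ->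
  (fun t : R => t ^- 2 * (f (p + t *: w + t *: u + t *: v) - f (p + t *: w + t *: u)
     - f (p + t *: w + t *: v) + f (p + t *: w))) t @[t --> 0^'+] --> 'D_v ('D_u f) p.
Proof.
move=> oO Op df cf; apply/cvgrPdist_le => e e0.
have : \forall q \near p, O q /\ `|'D_v ('D_u f) p - 'D_v ('D_u f) q| <= e.
  near=> q; split; near: q; first exact: open_nbhs_nbhs.
  by have /cvgrPdist_le := cf; apply.
move=> /nbhs_ballP [r /= r0 br].
(* All intermediate points lie within [t * L] of [p]; the added 1 keeps [L] positive when the three
   directions vanish. *)
pose L := `|w| + `|u| + `|v| + 1.
have L0 : 0 < L by rewrite ltr_wpDl ?addr_ge0.
have ballq t a b : 0 < t -> t < r / L -> 0 <= a <= t -> 0 <= b <= t ->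
    ball p r (p + t *: w + a *: u + b *: v).
  move=> t0 tr /andP[a0 at_] /andP[b0 bt].
  rewrite -ball_normE /ball_ /= -!addrA distrC [p + _]addrC addrK.
  apply: (@le_lt_trans _ _ (t * L)); last by rewrite -ltr_pdivlMr.
  apply: le_trans (ler_normD _ _) _; rewrite /L !mulrDr mulr1 -!addrA.
  rewrite normrZ gtr0_norm // lerD2l.
  apply: le_trans (ler_normD _ _) _; rewrite !normrZ !ger0_norm //.
  apply: lerD; first by apply: ler_wpM2r.
  by apply: ler_wpDr; [exact: ltW|apply: ler_wpM2r].
near=> t.
have t0 : 0 < t by near: t; exact: nbhs_right_gt.
have tr : t < r / L by near: t; apply: nbhs_right_lt; rewrite divr_gt0.
have [a b ha hb|a [b [ha hb ->]]] := @second_difference_mvt R V f (p + t *: w) u v t t0.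
  exact: df (br _ (ballq t a b t0 tr ha hb)).1.
rewrite mulrA mulVf ?mul1r; first exact: (br _ (ballq t a b t0 tr ha hb)).2.
by rewrite expf_neq0 // gt_eqF.
Unshelve. all: by end_near. Qed.

(** The second difference is symmetric in [u] and [v], and both mixed derivatives are its limit. *)
Lemma deriveC (R : realType) (V : normedModType R) (O : set V)
    (f : V -> R) (p u v : V) :
  open O -> O p ->
  (forall q, O q -> [/\ differentiable f q, differentiable ('D_u f) q
     & differentiable ('D_v f) q]) ->
  {for p, continuous ('D_v ('D_u f))} -> {for p, continuous ('D_u ('D_v f))} ->
  'D_v ('D_u f) p = 'D_u ('D_v f) p.
Proof.
move=> oO Op df cvu cuv.
have h1 := @second_difference_cvg R V O f p u v 0 oO Op
  (fun q Oq => let: And3 a b _ := df q Oq in conj a b) cvu.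
have h2 := @second_difference_cvg R V O f p v u 0 oO Op
  (fun q Oq => let: And3 a _ b := df q Oq in conj a b) cuv.
rewrite -(cvg_lim (@norm_hausdorff R R) h1) -(cvg_lim (@norm_hausdorff R R) h2).
by apply: congr1; apply: congr2 => //; apply/funext => t;
  rewrite scaler0 addr0 (addrAC p (t *: u)); ring.
Qed.

Lemma derive_eq_in (R : realType) (V : normedModType R) (S : set V) (f g : V -> R) (v : V) :
  open S -> (forall p, S p -> f p = g p) -> forall p, S p -> 'D_v f p = 'D_v g p.
Proof.
move=> oS fg p Sp; apply: near_eq_derive; near=> q; apply: fg.
by near: q; exact: open_nbhs_nbhs.
Unshelve. all: by end_near. Qed.

Lemma derive_shift_in (R : realType) (V : normedModType R) (S : set V) (f : V -> R) (k v : V) :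
  open S -> (forall p, S p -> f (p + k) = f p) ->
  forall p, S p -> 'D_v f (p + k) = 'D_v f p.
Proof.
move=> oS fk p Sp; rewrite -(derive_eq_in v oS fk Sp) /derive.
have -> : (fun h : R => h^-1 *: (f (h *: v + (p + k)) - f (p + k))) =
    (fun h : R => h^-1 *: (f (h *: v + p + k) - f (p + k))).
  by apply/funext => h; rewrite addrA.
by [].
Qed.

#[local] Opaque derive.

(** The data provided by [smooth_on]. The argument is carried out for the extension [F], which is
    differentiable across t = 0 and t = 1, and returns to [u] only in the open slab. *)
Definition smooth_in (R : realType) (V : normedModType R) (O : set V) (F : V -> R) :=
  open O /\ forall (vs : seq V) (p : V), O p -> differentiable (iter_derive vs F) p.

Lemma smooth_in_deriveC (R : realType) (V : normedModType R) (O : set V)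
    (F : V -> R) (p u v : V) :
  smooth_in O F -> O p -> 'D_v ('D_u F) p = 'D_u ('D_v F) p.
Proof.
move=> [oO dF] Op; apply: (deriveC oO Op) => [q Oq||].
- by split; [exact: (dF [::])|exact: (dF [:: u])|exact: (dF [:: v])].
- by apply: differentiable_continuous; exact: (dF [:: v; u]).
- by apply: differentiable_continuous; exact: (dF [:: u; v]).
Qed.

(** * Second derivatives as quadratic forms of the Hessian *)

Lemma derive_rVE (R : realType) (n : nat) (f : 'rV[R]_n -> R) (p h : 'rV[R]_n) :
  differentiable f p -> 'D_h f p = \sum_j h 0 j * 'D_(ebase R j) f p.
Proof.
move=> df; rewrite deriveE // [in LHS](row_sum_delta h) raddf_sum /=.
by apply: eq_bigr => j _; rewrite linearZ /= deriveE.
Qed.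

Lemma derive_rV_prodE (R : realType) (n : nat) (f : 'rV[R]_n * R -> R)
    (p : 'rV[R]_n * R) (h : 'rV[R]_n) (s : R) :
  differentiable f p ->
  'D_(h, s) f p = \sum_j h 0 j * 'D_(dx R j) f p + s * 'D_(dt R n) f p.
Proof.
move=> df; rewrite deriveE //.
have -> : (h, s) = \sum_j h 0 j *: dx R j + s *: dt R n.
  have -> : \sum_j h 0 j *: dx R j = (h, 0).
    rewrite [in RHS](row_sum_delta h).
    rewrite (big_morph (fun x : 'rV[R]_n => (x, 0 : R)) (id1 := 0) (op1 := +%R)) //.
      by apply: eq_bigr => j _; rewrite /dx; congr (_, _); rewrite /= scaler0.
    by move=> x y; congr (_, _); rewrite /= addr0.
  by rewrite /dt; congr (_, _); rewrite /= ?scaler0 ?addr0 // add0r [RHS]mulr1.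
rewrite raddfD raddf_sum /= linearZ /= deriveE //; congr (_ + _).
by apply: eq_bigr => j _; rewrite linearZ /= deriveE.
Qed.

(** Pure algebra for the Hessian: [x], [X] and [xt] stand for the derivatives of ['D_(h, s) F] along
    (h, s), along the coordinates of x, and along t. *)
Lemma qform_expand (R : realType) (n : nat) (A : 'M[R]_n) (b h X : 'rV[R]_n)
    (a s x xt : R) :
  x = \sum_j h 0 j * X 0 j + s * xt ->
  (forall j, X 0 j = \sum_k h 0 k * A k j + s * b 0 j) ->
  xt = \sum_k h 0 k * b 0 k + s * a ->
  qform A b a h s = x.
Proof.
move=> -> hX ->.
have -> : \sum_j h 0 j * X 0 j = (h *m A *m h^T) 0 0 + s * dotrv b h.
  have -> : \sum_j h 0 j * X 0 j =
     \sum_j (h 0 j * (\sum_k h 0 k * A k j) + s * (h 0 j * b 0 j)).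
    by apply: eq_bigr => j _; rewrite hX; ring.
  rewrite big_split /= -mulr_sumr; congr (_ + _ * _).
    rewrite !mxE; apply: eq_bigr => j _; rewrite !mxE mulrC; congr (_ * _).
  by rewrite dotrvE; apply: eq_bigr => j _; rewrite mulrC.
rewrite /qform dotrvE.
have -> : \sum_k h 0 k * b 0 k = \sum_k b 0 k * h 0 k.
  by apply: eq_bigr => k _; rewrite mulrC.
ring.
Qed.

Lemma smooth_in_derive1 (R : realType) (V : normedModType R) (O : set V)
    (F : V -> R) (p u : V) : smooth_in O F -> O p -> differentiable ('D_u F) p.
Proof. by move=> [_ dF] Op; exact: (dF [:: u]). Qed.

Lemma qform_hessian (R : realType) (n : nat) (O : set ('rV[R]_n * R))
    (F : 'rV[R]_n * R -> R) (p : 'rV[R]_n * R) (h : 'rV[R]_n) (s : R) :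
  smooth_in O F -> O p ->
  qform (hessian (@dx R n) F p) (\row_j 'D_(dt R n) ('D_(dx R j) F) p)
    ('D_(dt R n) ('D_(dt R n) F) p) h s = 'D_(h, s) ('D_(h, s) F) p.
Proof.
move=> sF Op.
pose G v := 'D_v F.
have dG v : differentiable (G v) p by exact: smooth_in_derive1 sF Op.
have GC u v : 'D_u (G v) p = 'D_v (G u) p by exact: smooth_in_deriveC sF Op.
have GE v : 'D_(h, s) (G v) p =
    \sum_j h 0 j * 'D_(dx R j) (G v) p + s * 'D_(dt R n) (G v) p.
  exact: derive_rV_prodE (dG v).
have -> : hessian (@dx R n) F p = \matrix_(i, j) 'D_(dx R i) (G (dx R j)) p by [].
have -> : \row_j 'D_(dt R n) ('D_(dx R j) F) p = \row_j 'D_(dt R n) (G (dx R j)) p by [].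
change ('D_(dt R n) ('D_(dt R n) F) p) with ('D_(dt R n) (G (dt R n)) p).
change ('D_(h, s) ('D_(h, s) F) p) with ('D_(h, s) (G (h, s)) p).
move: G dG GC GE => G dG GC GE.
apply: (@qform_expand _ _ _ _ h (\row_j 'D_(dx R j) (G (h, s)) p) _ s _
  ('D_(dt R n) (G (h, s)) p)).
- by rewrite GE; congr (_ + _); apply: eq_bigr => j _; rewrite mxE.
- move=> j; rewrite !mxE GC GE; congr (_ + _); apply: eq_bigr => k _; by rewrite mxE.
- by rewrite GC GE; congr (_ + _); apply: eq_bigr => j _; rewrite mxE GC.
Qed.

Lemma hessian_sym (R : realType) (V : normedModType R) (n : nat) (e : 'I_n -> V)
    (O : set V) (F : V -> R) (p : V) :
  smooth_in O F -> O p -> (hessian e F p)^T = hessian e F p.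
Proof.
by move=> sF Op; apply/matrixP => i j; rewrite !mxE; exact: smooth_in_deriveC sF Op.
Qed.

Lemma hessian_formE (R : realType) (n : nat) (O : set 'rV[R]_n)
    (F : 'rV[R]_n -> R) (p : 'rV[R]_n) (h : 'rV[R]_n) :
  smooth_in O F -> O p ->
  (h *m hessian (@ebase R n) F p *m h^T) 0 0 = 'D_h ('D_h F) p.
Proof.
move=> sF Op.
pose G v := 'D_v F.
have dG v : differentiable (G v) p by exact: smooth_in_derive1 sF Op.
have GC u v : 'D_u (G v) p = 'D_v (G u) p by exact: smooth_in_deriveC sF Op.
have GE v : 'D_h (G v) p = \sum_j h 0 j * 'D_(ebase R j) (G v) p.
  exact: derive_rVE (dG v).
have -> : hessian (@ebase R n) F p = \matrix_(i, j) 'D_(ebase R i) (G (ebase R j)) p by [].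
change ('D_h ('D_h F) p) with ('D_h (G h) p).
move: G dG GC GE => G dG GC GE.
rewrite GE mxE; apply: eq_bigr => j _; rewrite !mxE mulrC; congr (_ * _).
by rewrite GC GE; apply: eq_bigr => k _; rewrite !mxE.
Qed.

(** * Tangent inequalities, finite means and Jensen's inequality *)

Lemma second_order_tangent (R : realType) (f df ddf : R -> R) :
  (forall r : R, 0 <= r <= 1 -> is_derive r 1 f (df r)) ->
  (forall r : R, 0 <= r <= 1 -> is_derive r 1 df (ddf r)) ->
  (forall r : R, 0 <= r <= 1 -> 0 <= ddf r) ->
  f 0 + df 0 <= f 1.
Proof.
move=> h1 h2 h3; have [r /andP[r0 r1] hr] := MVT_from0 ltr01 h1.
rewrite mul1r in hr; rewrite -lerBrDl hr.
move: r0; rewrite le_eqVlt => /predU1P[<- //|r0].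
have [a|a /andP[a0 ar] ha] := MVT_from0 r0 (df := ddf) (f := df).
  by move=> /andP[a0 ar]; apply: h2; rewrite a0 (le_trans ar).
by rewrite -subr_ge0 ha mulr_ge0 ?(ltW r0) // h3 // a0 (le_trans ar).
Qed.

Definition meanr (R : realType) (N : nat) (c : 'I_N.+1 -> R) : R :=
  N.+1%:R^-1 * \sum_i c i.

Definition meanv (R : realType) (n N : nat) (X : 'I_N.+1 -> 'rV[R]_n) : 'rV[R]_n :=
  N.+1%:R^-1 *: \sum_i X i.

(** The variance of the configuration for the uniform weights. *)
Definition spread (R : realType) (n N : nat) (X : 'I_N.+1 -> 'rV[R]_n) : R :=
  meanr (fun i => dotrv (X i - meanv X) (X i - meanv X)).

Lemma meanrD (R : realType) (N : nat) (c d : 'I_N.+1 -> R) :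
  meanr (fun i => c i + d i) = meanr c + meanr d.
Proof. by rewrite /meanr big_split mulrDr. Qed.

Lemma meanrZ (R : realType) (N : nat) k (c : 'I_N.+1 -> R) :
  meanr (fun i => k * c i) = k * meanr c.
Proof. by rewrite /meanr -mulr_sumr mulrCA. Qed.

Lemma meanrB (R : realType) (N : nat) (c d : 'I_N.+1 -> R) :
  meanr (fun i => c i - d i) = meanr c - meanr d.
Proof. by rewrite /meanr sumrB mulrBr. Qed.

Lemma meanr_cst (R : realType) (N : nat) (k : R) :
  meanr (fun _ : 'I_N.+1 => k) = k.
Proof. by rewrite /meanr sumr_const card_ord -[k *+ _]mulr_natl mulKf // pnatr_eq0. Qed.

Lemma eq_meanr (R : realType) (N : nat) (c d : 'I_N.+1 -> R) :
  c =1 d -> meanr c = meanr d.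
Proof. by move=> cd; rewrite /meanr (eq_bigr _ (fun i _ => cd i)). Qed.

Lemma le_meanr (R : realType) (N : nat) (c d : 'I_N.+1 -> R) :
  (forall i, c i <= d i) -> meanr c <= meanr d.
Proof. by move=> cd; rewrite /meanr ler_wpM2l ?invr_ge0 // ler_sum. Qed.

Lemma meanvD (R : realType) (n N : nat) (X Y : 'I_N.+1 -> 'rV[R]_n) :
  meanv (fun i => X i + Y i) = meanv X + meanv Y.
Proof. by rewrite /meanv big_split /= scalerDr. Qed.

Lemma meanvZ (R : realType) (n N : nat) k (X : 'I_N.+1 -> 'rV[R]_n) :
  meanv (fun i => k *: X i) = k *: meanv X.
Proof. by rewrite /meanv [RHS]scalerA mulrC -[RHS]scalerA [in RHS]scaler_sumr. Qed.

Lemma meanv_cst (R : realType) (n N : nat) (k : 'rV[R]_n) :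
  meanv (fun _ : 'I_N.+1 => k) = k.
Proof.
by rewrite /meanv sumr_const card_ord -[k *+ _]scaler_nat scalerA mulVf ?scale1r // pnatr_eq0.
Qed.

Lemma meanr_dotrvl (R : realType) (n N : nat) (X : 'I_N.+1 -> 'rV[R]_n) (y : 'rV[R]_n) :
  meanr (fun i => dotrv (X i) y) = dotrv (meanv X) y.
Proof.
rewrite /meanr /meanv dotrvZl; congr (_ * _).
by rewrite /dotrv mulmx_suml summxE.
Qed.

Lemma spreadE (R : realType) (n N : nat) (X : 'I_N.+1 -> 'rV[R]_n) :
  spread X = meanr (fun i => dotrv (X i) (X i)) - dotrv (meanv X) (meanv X).
Proof.
rewrite /spread; set y := meanv X.
have -> : meanr (fun i => dotrv (X i - y) (X i - y)) =
    meanr (fun i => (dotrv (X i) (X i) - 2 * dotrv (X i) y) + dotrv y y).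
  by apply: eq_meanr => i; rewrite dotrvBl !dotrvBr (dotrvC y (X i)); ring.
by rewrite meanrD meanrB meanrZ meanr_dotrvl meanr_cst -/y; ring.
Qed.

Lemma spread_shift (R : realType) (n N : nat) (X : 'I_N.+1 -> 'rV[R]_n) (k : 'rV[R]_n) :
  spread (fun i => X i + k) = spread X.
Proof.
rewrite /spread meanvD meanv_cst; apply: eq_meanr => i.
by rewrite opprD addrACA subrr addr0.
Qed.

(** The identity is exact, without remainder, because [spread] is a quadratic form in the
    configuration. *)
Lemma spread_second_difference (R : realType) (n N : nat) (X H : 'I_N.+1 -> 'rV[R]_n) (t : R) :
  spread (fun i => X i + t *: H i) + spread (fun i => X i - t *: H i) - 2 * spread X =
  2 * t ^+ 2 * spread H.
Proof.
have -> : (fun i => X i - t *: H i) = (fun i => X i + (- t) *: H i).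
  by apply/funext => i; rewrite scaleNr.
have e s : spread (fun i => X i + s *: H i) = spread X +
    2 * s * (meanr (fun i => dotrv (X i) (H i)) - dotrv (meanv X) (meanv H)) +
    s ^+ 2 * spread H.
  rewrite !spreadE meanvD meanvZ.
  have -> : meanr (fun i => dotrv (X i + s *: H i) (X i + s *: H i)) =
      meanr (fun i => dotrv (X i) (X i)) + 2 * s * meanr (fun i => dotrv (X i) (H i))
      + s ^+ 2 * meanr (fun i => dotrv (H i) (H i)).
    rewrite -!meanrZ -!meanrD; apply: eq_meanr => i.
    by rewrite dotrvDl !dotrvDr !dotrvZl !dotrvZr (dotrvC (H i)); ring.
  move: (meanv X) (meanv H) => x h.
  by rewrite dotrvDl !dotrvDr !dotrvZl !dotrvZr (dotrvC h); ring.
by rewrite !e; ring.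
Qed.

(** Subtracting the parabola [k / 2 * dotrv h h * r ^+ 2] from [f (x + r *: h)] leaves a function of
    [r] with nonnegative second derivative. *)
Lemma tangent_le (R : realType) (n : nat) (f : 'rV[R]_n -> R) (k : R) (x h : 'rV[R]_n) :
  smooth_in setT f ->
  (forall y, k * dotrv h h <= 'D_h ('D_h f) y) ->
  f x + 'D_h f x + k / 2 * dotrv h h <= f (x + h).
Proof.
move=> sf hk; have [_ df] := sf.
pose g r := f (x + r *: h) + (- (k / 2 * dotrv h h)) *: r ^+ 2.
pose dg r := 'D_h f (x + r *: h) + (- (k / 2 * dotrv h h)) *: (2 * r).
pose ddg r := 'D_h ('D_h f) (x + r *: h) + (- (k / 2 * dotrv h h)) *: (2 : R).
have d1 (r : R) : is_derive r 1 (fun t => f (x + t *: h)) ('D_h f (x + r *: h)).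
  by apply: is_derive_line; exact: (df [::]).
have d2 (r : R) : is_derive r 1 (fun t => 'D_h f (x + t *: h)) ('D_h ('D_h f) (x + r *: h)).
  by apply: is_derive_line; exact: (df [:: h]).
have := @second_order_tangent R g dg ddg.
rewrite /g /dg /ddg !scale0r !scale1r !addr0 expr0n mulr0 !scaler0 !addr0 expr1n => H.
suff : f x + 'D_h f x <= f (x + h) + (- (k / 2 * dotrv h h)) *: (1 : R).
  by rewrite [_ *: 1]mulr1; lra.
apply: H => r _.
- have dsqr : is_derive r 1 (fun t : R => t ^+ 2) (2 * r).
    apply: DeriveDef; first exact: exprn_derivable.
    by rewrite exp_derive [_ *: 1]mulr1 expr1.
  by apply: is_deriveD (is_deriveZ _ dsqr).
- have dlin : is_derive r 1 (fun t : R => 2 * t) 2.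
    by apply: is_derive_eq (is_deriveZ _ (is_derive_id r 1)) _; rewrite [_ *: 1]mulr1.
  by apply: is_deriveD (is_deriveZ _ dlin).
- by have := hk (x + r *: h); rewrite [_ *: 2]mulrC; lra.
Qed.

(** Average the tangent inequalities at the mean point: the first-order terms cancel and the
    quadratic ones add up to the variance. The constant [k] may be negative, as it is for the
    boundary data. *)
Lemma jensen_spread (R : realType) (n N : nat) (f : 'rV[R]_n -> R) (k : R)
    (X : 'I_N.+1 -> 'rV[R]_n) :
  smooth_in setT f ->
  (forall y h, k * dotrv h h <= 'D_h ('D_h f) y) ->
  f (meanv X) + k / 2 * spread X <= meanr (fun i => f (X i)).
Proof.
move=> sf hk; have [_ df] := sf; set y := meanv X.
have : meanr (fun i => f y + 'D_(X i - y) f y + k / 2 * dotrv (X i - y) (X i - y)) <=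
    meanr (fun i => f (X i)).
  apply: le_meanr => i.
  by have := tangent_le y sf (fun z => hk z (X i - y)); rewrite (addrC y) subrK.
rewrite !meanrD meanr_cst meanrZ -/(spread X).
suff -> : meanr (fun i => 'D_(X i - y) f y) = 0 by rewrite addr0.
have dfy : differentiable f y by exact: (df [::]).
have -> : meanr (fun i => 'D_(X i - y) f y) =
   meanr (fun i => 'd f y (X i) - 'd f y y).
  by apply: eq_meanr => i; rewrite deriveE // raddfB.
rewrite meanrB meanr_cst /meanr -raddf_sum -[_ * _]/(_ *: _) -linearZ /=.
by rewrite -/(meanv X) subrr.
Qed.

(** * Compactness and the maximum of the N-point function *)

Lemma cvg_sum_ord (R : realType) (V : normedModType R) (T : Type) (F : set_system T)
    (FF : Filter F) (N : nat) (f : 'I_N -> T -> V) (l : 'I_N -> V) :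
  (forall i, f i x @[x --> F] --> l i) ->
  (\sum_i f i x) @[x --> F] --> \sum_i l i.
Proof.
move=> fl; elim: (index_enum _) => [|i s IH].
  rewrite big_nil.
  have -> : (fun x => \sum_(i <- [::]) f i x) = (fun=> 0 : V).
    by apply/funext => x; rewrite big_nil.
  exact: cvg_cst.
rewrite big_cons.
have -> : (fun x => \sum_(j <- i :: s) f j x) = (fun x => f i x + \sum_(j <- s) f j x).
  by apply/funext => x; rewrite big_cons.
exact: cvgD.
Qed.

Lemma row_proj_continuous (T : topologicalType) (N : nat) (i : 'I_N) :
  continuous (fun X : 'rV[T]_N => X ord0 i).
Proof.
move=> X U XU; exists (fun (_ : 'I_1) j => if j == i then U else setT).
  by move=> a j; rewrite (ord1 a); case: eqP => [->//|_]; exact: filterT.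
by move=> Y /(_ ord0 i); rewrite eqxx.
Qed.

Definition box (R : realType) (n : nat) (L : R) : set 'rV[R]_n :=
  [set x | forall j, `[- L, L]%classic (x 0 j)].

Lemma box_compact (R : realType) (n : nat) (L : R) : compact (@box R n L).
Proof. by apply: (rV_compact (A := fun=> `[- L, L]%classic)) => j; exact: segment_compact. Qed.

Lemma unit_translate (R : realType) (n : nat) (x : 'rV[R]_n) :
  exists k : 'rV[int]_n, forall j, 0 <= (x + map_mx intr k) 0 j <= 1.
Proof.
exists (\row_j - Num.floor (x 0 j)) => j; rewrite !mxE.
have /andP[h1 h2] := floor_itv (x 0 j).
by move: h1 h2; rewrite intrD raddfN /=; lra.
Qed.

(** Integer translations reduce the bound to a compact box times [0,1]. Periodicity is asked on [T]
    only, because for second derivatives it is established in the open slab, whereas continuity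
    holds up to t = 0 and t = 1. *)
Lemma periodic_bounded (R : realType) (n : nat) (G : 'rV[R]_n * R -> R) (T : set R) :
  (forall t, T t -> 0 <= t <= 1) ->
  (forall x t, 0 <= t <= 1 -> {for (x, t), continuous G}) ->
  (forall t, T t -> Zn_periodic (fun x => G (x, t))) ->
  exists C, forall x t, T t -> `|G (x, t)| <= C.
Proof.
move=> T01 cG pG.
pose K : set ('rV[R]_n * R) := @box R n 1 `*` `[0, 1]%classic.
have cK : compact K by apply: compact_setX; [exact: box_compact|exact: segment_compact].
have [||c Kc hc] := @compact_EVT_max _ R (fun p => `|G p|) K _ cK.
- by exists (0, 0); split => [j|] /=; rewrite ?mxE in_itv /= ?lexx ?ler01 ?lerN10.
- apply: continuous_in_subspaceT => -[x t]; rewrite inE => -[_ /=].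
  rewrite in_itv /= => ht.
  by apply: cvg_norm; exact: cG.
exists `|G c| => x t Tt.
have [k hk] := unit_translate x.
rewrite -(pG t Tt x k); apply: (hc (_, _)); rewrite inE; split => [j|] /=.
  by rewrite in_itv /=; move: (hk j); lra.
by rewrite in_itv /= T01.
Qed.

(** For [d >= 0] the last term is nonpositive on [0,1]; it vanishes at both ends and contributes
    [2 * d * s ^+ 2] to second derivatives in a direction with time component [s]. *)
Definition gap (R : realType) (n N : nat) (F : 'rV[R]_n * R -> R) (c d : R)
    (X : 'I_N.+1 -> 'rV[R]_n) (t : R) : R :=
  F (meanv X, t) - meanr (fun i => F (X i, t)) - c * spread X + d * (t ^+ 2 - t).

(** Configurations are encoded as rows of vectors, so that they carry a product topology in which
    boxes are compact. *)
Lemma gap_continuous (R : realType) (n N : nat) (F : 'rV[R]_n * R -> R) (c d : R)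
    (X : 'rV['rV[R]_n]_N.+1) (t : R) :
  (forall x, {for (x, t), continuous F}) ->
  {for (X, t), continuous (fun p : 'rV['rV[R]_n]_N.+1 * R => gap F c d (p.1 ord0) p.2)}.
Proof.
move=> cF.
pose T : Type := ('rV['rV[R]_n]_N.+1 * R)%type.
have c1 (i : 'I_N.+1) : (fun p : T => p.1 ord0 i : 'rV[R]_n) p @[p --> (X, t)] --> (X ord0 i : 'rV[R]_n).
  apply: (@cvg_comp _ _ _ (fun p : 'rV['rV[R]_n]_N.+1 * R => p.1) (fun Y => Y ord0 i) _ (nbhs X)).
    exact: cvg_fst.
  exact: row_proj_continuous.
have c2 : (fun p : T => p.2) p @[p --> (X, t)] --> t by exact: cvg_snd.
have cm : (fun p : T => meanv (p.1 ord0) : 'rV[R]_n) p @[p --> (X, t)] --> (meanv (X ord0) : 'rV[R]_n).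
  by apply: cvgZl_tmp; apply: cvg_sum_ord.
have cFx (g : 'rV['rV[R]_n]_N.+1 * R -> 'rV[R]_n) x :
    g p @[p --> (X, t)] --> x -> F (g p, p.2) @[p --> (X, t)] --> F (x, t).
  move=> cg; apply: (@cvg_comp _ _ _ (fun p => (g p, p.2)) F _ (nbhs (x, t))).
    exact: (cvg_pair cg c2).
  exact: cF.
have cdot (g : 'rV['rV[R]_n]_N.+1 * R -> 'rV[R]_n) x :
    g p @[p --> (X, t)] --> x -> dotrv (g p) (g p) @[p --> (X, t)] --> dotrv x x.
  move=> cg; have -> : (fun p => dotrv (g p) (g p)) = (fun p => \sum_j g p 0 j * g p 0 j).
    by apply/funext => p; rewrite dotrvE.
  rewrite dotrvE; apply: cvg_sum_ord => j.
  have cgj : g p 0 j @[p --> (X, t)] --> x 0 j.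
    exact: (cvg_comp _ _ cg (@coord_continuous _ _ _ 0 j x)).
  exact: cvgM.
have csq : (fun p : T => p.2 ^+ 2) p @[p --> (X, t)] --> t ^+ 2.
  exact: (cvg_comp _ _ c2 (@exprn_continuous _ 2 t)).
apply: cvgD; last by apply: cvgM; [exact: cvg_cst|exact: cvgB csq c2].
apply: cvgB; last first.
  apply: cvgM; first exact: cvg_cst.
  apply: cvgM; first exact: cvg_cst.
  apply: cvg_sum_ord => i; apply: cdot; exact: cvgB.
apply: cvgB; first exact: cFx.
by apply: cvgM; [exact: cvg_cst|apply: cvg_sum_ord => i; exact: cFx].
Qed.

(* The joint translations by Z^n and the coercivity in the differences
   [X i - meanv X] make up for the noncompactness of the configuration space. *)
Lemma gap_max (R : realType) (n N : nat) (F : 'rV[R]_n * R -> R) (c d : R)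
    (X1 : 'I_N.+1 -> 'rV[R]_n) (t1 : R) :
  0 < c -> 0 <= d ->
  (forall x t, 0 <= t <= 1 -> {for (x, t), continuous F}) ->
  (forall t, 0 <= t <= 1 -> Zn_periodic (fun x => F (x, t))) ->
  0 <= t1 <= 1 -> 0 < gap F c d X1 t1 ->
  exists (X0 : 'I_N.+1 -> 'rV[R]_n) (t0 : R), [/\ 0 <= t0 <= 1, 0 < gap F c d X0 t0 &
    forall (X : 'I_N.+1 -> 'rV[R]_n) t, 0 <= t <= 1 -> gap F c d X t <= gap F c d X0 t0].
Proof.
move=> c0 d0 cF pF t101 gap1.
have [B hB] := @periodic_bounded R n F `[0, 1]%classic (fun t => id)
  cF pF.
have B0 : 0 <= B.
  by apply: le_trans (hB 0 0 _); rewrite //= in_itv /= lexx ler01.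
(* A positive gap forces the variance below [2 * B / c], hence each squared coordinate of
   [X i - meanv X] below [l - 1]; the summand 1 avoids a square root. *)
pose l := 1 + 2 * B * N.+1%:R / c.
have l0 : 1 <= l.
  by rewrite lerDl divr_ge0 ?(ltW c0) // mulr_ge0 // mulr_ge0.
have reduce (X : 'I_N.+1 -> 'rV[R]_n) t : 0 <= t <= 1 -> 0 < gap F c d X t ->
    exists Y : 'I_N.+1 -> 'rV[R]_n, (forall i, box (1 + 2 * l) (Y i)) /\ gap F c d Y t = gap F c d X t.
  (* The translation brings the point of index [ord0] into the unit cube; every other coordinate
     then differs from its own by at most [2 * l]. *)
  move=> t01 gX; have [k hk] := unit_translate (X ord0).
  pose z : 'rV[R]_n := map_mx intr k.
  exists (fun i => X i + z); split; last first.
    rewrite /gap spread_shift meanvD meanv_cst (pF t t01).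
    by congr (_ - _ - _ + _); apply: eq_meanr => i; exact: (pF t t01 (X i) k).
  have sp : spread X <= 2 * B / c.
    rewrite ler_pdivlMr //.
    have h1 : F (meanv X, t) <= B by apply: le_trans (ler_norm _) (hB _ _ _).
    have h2 : - B <= meanr (fun i => F (X i, t)).
      rewrite -(meanr_cst N (- B)); apply: le_meanr => i.
      by have := hB (X i) t t01; rewrite ler_norml => /andP[].
    have h3 : d * (t ^+ 2 - t) <= 0.
      by apply: mulr_ge0_le0 => //; case/andP: t01 => ? ?; nra.
    by move: gX; rewrite /gap; lra.
  have coord i j : `|(X i - meanv X) 0 j| <= l.
    set y := X i - meanv X.
    have : (y 0 j) ^+ 2 <= 2 * B * N.+1%:R / c.
      apply: (@le_trans _ _ (dotrv y y)).
        rewrite dotrvE (bigD1 j) //= -expr2 lerDl sumr_ge0 // => a _.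
        by rewrite -expr2 sqr_ge0.
      apply: (@le_trans _ _ (N.+1%:R * spread X)).
        rewrite /spread /meanr mulVKf ?pnatr_eq0 // (bigD1 i) //= lerDl.
        by rewrite sumr_ge0 // => a _; exact: dotrv_ge0.
      have -> : 2 * B * N.+1%:R / c = N.+1%:R * (2 * B / c) by ring.
      by rewrite ler_wpM2l.
    rewrite /l; set w := y 0 j => hw.
    by rewrite ler_norml; apply/andP; split; nra.
  move=> i j.
  suff : - (1 + 2 * l) <= (X i + z) 0 j <= 1 + 2 * l by rewrite /= in_itv.
  have := coord i j; have := coord ord0 j; have := hk j.
  rewrite /z !mxE !ler_norml; move: (_ * _) => m.
  by move=> /andP[? ?] /andP[? ?] /andP[? ?]; apply/andP; split; lra.
pose K : set ('rV['rV[R]_n]_N.+1 * R) :=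
  [set X : 'rV['rV[R]_n]_N.+1 | forall i, @box R n (1 + 2 * l) (X ord0 i)] `*` `[0, 1]%classic.
have cK : compact K.
  apply: compact_setX; last exact: segment_compact.
  by apply: (rV_compact (A := fun=> @box R n (1 + 2 * l))) => i; exact: box_compact.
pose g (p : 'rV['rV[R]_n]_N.+1 * R) := gap F c d (p.1 ord0) p.2.
have toK (X : 'I_N.+1 -> 'rV[R]_n) t : 0 <= t <= 1 -> 0 < gap F c d X t ->
    exists2 p, K p & g p = gap F c d X t.
  move=> t01 gX; have [Y [hY <-]] := reduce X t t01 gX.
  have rY : (\row_i Y i : 'rV['rV[R]_n]_N.+1) ord0 = Y by apply/funext => i; rewrite mxE.
  exists (\row_i Y i, t); last by rewrite /g /= rY.
  by split => [i|] /=; [rewrite rY|rewrite in_itv].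
have [p1 Kp1 gp1] := toK _ _ t101 gap1.
have [||q Kq hq] := @compact_EVT_max _ R g K _ cK.
- by exists p1.
- apply: continuous_in_subspaceT => -[X t]; rewrite inE => -[_ /=].
  by rewrite in_itv /= => ht; apply: gap_continuous => x; exact: cF.
have gq : 0 < g q by apply: lt_le_trans (hq p1 _); rewrite ?gp1 ?inE.
exists (q.1 ord0), q.2; split => // [|X t t01].
  by move: Kq; rewrite inE => -[_]; rewrite /= in_itv.
(* Only configurations with positive gap can be moved into [K]; for the others the positive value at
   [q] is already larger. *)
have [gle|gX] := lerP (gap F c d X t) 0; first exact: le_trans gle (ltW gq).
have [p Kp <-] := toK X t t01 gX.
by apply: hq; rewrite inE.
Qed.

(** * Second-order condition at an interior maximum *)

Lemma symmetric_difference_cvg (R : realType) (V : normedModType R) (O : set V)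
    (f : V -> R) (p v : V) :
  smooth_in O f -> O p ->
  (fun t : R => t ^- 2 * (f (p + t *: v) + f (p - t *: v) - 2 * f p)) t @[t --> 0^'+]
    --> 'D_v ('D_v f) p.
Proof.
move=> sf Op; have [oO df] := sf.
have H := @second_difference_cvg R V O f p v v (- v) oO Op
  (fun q Oq => conj (df [::] q Oq) (smooth_in_derive1 v sf Oq))
  (differentiable_continuous (df [:: v; v] p Op)).
have -> : (fun t : R => t ^- 2 * (f (p + t *: v) + f (p - t *: v) - 2 * f p)) =
   (fun t => t ^- 2 * (f (p + t *: - v + t *: v + t *: v) - f (p + t *: - v + t *: v)
     - f (p + t *: - v + t *: v) + f (p + t *: - v))).
  apply/funext => t; rewrite scalerN addrNK; congr (_ * _); ring.
exact: H.
Qed.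

Lemma meanr_cvg (R : realType) (N : nat) (T : Type) (F : set_system T) (FF : Filter F)
    (f : 'I_N.+1 -> T -> R) (l : 'I_N.+1 -> R) :
  (forall i, f i x @[x --> F] --> l i) ->
  (fun x => meanr (fun i => f i x)) x @[x --> F] --> meanr l.
Proof. by move=> fl; apply: cvgM; [exact: cvg_cst|exact: cvg_sum_ord]. Qed.

(** Compare the maximum with the values at (X + r H, t + r s) and (X - r H, t - r s), divide by r^2
    and let r tend to 0. *)
Lemma gap_second_order (R : realType) (n N : nat) (O : set ('rV[R]_n * R))
    (F : 'rV[R]_n * R -> R) (c d : R) (X H : 'I_N.+1 -> 'rV[R]_n) (t s : R) :
  smooth_in O F -> (forall x r, 0 <= r <= 1 -> O (x, r)) -> 0 < t < 1 ->
  (forall (Y : 'I_N.+1 -> 'rV[R]_n) r, 0 <= r <= 1 -> gap F c d Y r <= gap F c d X t) ->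
  'D_(meanv H, s) ('D_(meanv H, s) F) (meanv X, t)
    - meanr (fun i => 'D_(H i, s) ('D_(H i, s) F) (X i, t))
    - 2 * c * spread H + 2 * d * s ^+ 2 <= 0.
Proof.
move=> sF O01 /andP[t0 t1] hmax.
have Ot x : O (x, t) by apply: O01; rewrite !ltW.
pose D (q v : 'rV[R]_n * R) (r : R) := F (q + r *: v) + F (q - r *: v) - 2 * F q.
pose phi r := r ^- 2 * D (meanv X, t) (meanv H, s) r -
  meanr (fun i => r ^- 2 * D (X i, t) (H i, s) r) - 2 * c * spread H + 2 * d * s ^+ 2.
have cphi : phi r @[r --> 0^'+] --> 'D_(meanv H, s) ('D_(meanv H, s) F) (meanv X, t)
    - meanr (fun i => 'D_(H i, s) ('D_(H i, s) F) (X i, t))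
    - 2 * c * spread H + 2 * d * s ^+ 2.
  apply: cvgD; last exact: cvg_cst.
  apply: cvgB; last exact: cvg_cst.
  apply: cvgB; first exact: symmetric_difference_cvg sF (Ot _).
  by apply: meanr_cvg => i; exact: symmetric_difference_cvg sF (Ot _).
apply: (ler_cvg_to cphi (cvg_cst 0)).
(* For [r < e] both times [t + r * s] and [t - r * s] stay in [0,1], where maximality is known. *)
pose e := Num.min t (1 - t) / (`|s| + 1).
have s1 : 0 < `|s| + 1 by rewrite ltr_wpDl.
have e0 : 0 < e by rewrite divr_gt0 // lt_min t0 subr_gt0.
near=> r.
have r0 : 0 < r by near: r; exact: nbhs_right_gt.
have re : r < e by near: r; apply: nbhs_right_lt.
have rs : `|r * s| <= Num.min t (1 - t).
  rewrite normrM gtr0_norm //; apply: (@le_trans _ _ (r * (`|s| + 1))).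
    by apply: ler_wpM2l; [exact: ltW|rewrite lerDl].
  by rewrite -ler_pdivlMr // ltW.
have [rt1 rt2] : 0 <= t + r * s <= 1 /\ 0 <= t - r * s <= 1.
  by move: rs; rewrite le_min !ler_norml => /andP[/andP[? ?] /andP[? ?]]; split;
    apply/andP; split; lra.
have h1 := hmax (fun i => X i + r *: H i) _ rt1.
have h2 := hmax (fun i => X i - r *: H i) _ rt2.
have sp := spread_second_difference X H r.
have e1 : D (meanv X, t) (meanv H, s) r = F (meanv (fun i => X i + r *: H i), t + r * s)
   + F (meanv (fun i => X i - r *: H i), t - r * s) - 2 * F (meanv X, t).
  have -> : (fun i => X i - r *: H i) = (fun i => X i + (- r) *: H i).
    by apply/funext => i; rewrite scaleNr.
  by rewrite !meanvD !meanvZ scaleNr.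
have e2 : meanr (fun i => D (X i, t) (H i, s) r) =
   meanr (fun i => F (X i + r *: H i, t + r * s)) +
   meanr (fun i => F (X i - r *: H i, t - r * s)) - 2 * meanr (fun i => F (X i, t)).
  by rewrite -meanrD -meanrZ -meanrB.
have hD : D (meanv X, t) (meanv H, s) r - meanr (fun i => D (X i, t) (H i, s) r)
    - c * (2 * r ^+ 2 * spread H) + 2 * d * (r ^+ 2 * s ^+ 2) <= 0.
  rewrite e1 e2 -sp; move: h1 h2; rewrite /gap; lra.
rewrite /phi meanrZ.
have -> : r ^- 2 * D (meanv X, t) (meanv H, s) r -
    r ^- 2 * meanr (fun i => D (X i, t) (H i, s) r) - 2 * c * spread H + 2 * d * s ^+ 2 =
  r ^- 2 * (D (meanv X, t) (meanv H, s) r - meanr (fun i => D (X i, t) (H i, s) r)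
    - c * (2 * r ^+ 2 * spread H) + 2 * d * (r ^+ 2 * s ^+ 2)).
  by field; rewrite gt_eqF.
by rewrite pmulr_rle0 // invr_gt0 exprn_gt0.
Unshelve. all: by end_near. Qed.

(** * Alternating configurations and bounds uniform in the number of points *)

Lemma form_lower_bound (R : realType) (n : nat) (A : 'M[R]_n) (C : R) (h : 'rV[R]_n) :
  (forall i j, `|A i j| <= C) ->
  - (C * n%:R) * dotrv h h <= (h *m A *m h^T) 0 0.
Proof.
move=> hA.
have -> : (h *m A *m h^T) 0 0 = \sum_j \sum_i h 0 i * A i j * h 0 j.
  by rewrite mxE; apply: eq_bigr => j _; rewrite !mxE mulr_suml.
(* Each product [h 0 i * A i j * h 0 j] is at least minus [C / 2] times the sum of the two
   squares. *)
apply: (@le_trans _ _ (\sum_(j < n) \sum_(i < n)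
    (- (C / 2) * (h 0 i * h 0 i) - C / 2 * (h 0 j * h 0 j)))).
  rewrite dotrvE.
  have -> : \sum_(j < n) \sum_(i < n) (- (C / 2) * (h 0 i * h 0 i) - C / 2 * (h 0 j * h 0 j))
      = \sum_(j < n) (- (C / 2) * (\sum_i h 0 i * h 0 i) - C / 2 * (n%:R * (h 0 j * h 0 j))).
    apply: eq_bigr => j _; rewrite sumrB -mulr_sumr sumr_const card_ord.
    by rewrite -[_ *+ n]mulr_natl; congr (_ - _); ring.
  rewrite sumrB sumr_const card_ord -[_ *+ n]mulr_natl -!mulr_sumr.
  by move: (\sum_i _) => S; rewrite le_eqVlt; apply/orP; left; apply/eqP; field.
apply: ler_sum => j _; apply: ler_sum => i _.
have := hA i j; rewrite ler_norml => /andP[h1 h2].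
have := sqr_ge0 (h 0 i - h 0 j); have := sqr_ge0 (h 0 i + h 0 j).
move: (h 0 i) (h 0 j) (A i j) h1 h2 => x y a h1 h2; nra.
Qed.

(** The size [K.*2.+2] is a visible successor, as the means require, and contains [K.+1] indices of
    each parity. *)
Lemma meanr_alternate (R : realType) (K : nat) (a b : R) :
  meanr (fun i : 'I_(K.*2.+2) => if odd i then a else b) = (a + b) / 2.
Proof.
have H k : \sum_(i < k.*2) (if odd i then a else b) = (a + b) *+ k.
  elim: k => [|k IH]; first by rewrite big_ord0.
  rewrite doubleS !big_ord_recr /= IH odd_double /= mulrSr -addrA; congr (_ + _).
  by rewrite addrC.
rewrite /meanr -doubleS (H K.+1) -[_ *+ K.+1]mulr_natr -muln2 natrM.
have : K.+1%:R != 0 :> R by rewrite pnatr_eq0.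
by move: (K.+1%:R) => m m0; field.
Qed.

Lemma gap_alternate (R : realType) (n K : nat) (F : 'rV[R]_n * R -> R) (c d t : R)
    (x h : 'rV[R]_n) :
  gap F c d (fun i : 'I_(K.*2.+2) => if odd i then x + h else x - h) t =
  F (x, t) - (F (x + h, t) + F (x - h, t)) / 2 - c * dotrv h h + d * (t ^+ 2 - t).
Proof.
set X := fun i => _.
have mX : meanv X = x.
  apply/rowP => j; rewrite mxE summxE.
  rewrite (eq_bigr (fun i : 'I_(K.*2.+2) => if odd i then (x + h) 0 j else (x - h) 0 j)).
    by rewrite -/(meanr _) meanr_alternate !mxE; field.
  by move=> i _; rewrite /X; case: ifP.
rewrite /gap /spread mX; congr (_ - _ - _ * _ + _).
  by rewrite -(meanr_alternate K); apply: eq_meanr => i; rewrite /X; case: ifP.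
have -> : dotrv h h = (dotrv h h + dotrv h h) / 2 by field.
rewrite -(meanr_alternate K); apply: eq_meanr => i; rewrite /X.
by case: ifP => _; rewrite addrC addKr // /dotrv -scaleN1r -scalemxAl linearZ /=
   -scalemxAr scalerA mulrNN mulr1 scale1r.
Qed.

Lemma second_derivative_ge (R : realType) (n : nat) (O : set ('rV[R]_n * R))
    (F : 'rV[R]_n * R -> R) (c t : R) (x h : 'rV[R]_n) :
  smooth_in O F -> O (x, t) ->
  (forall y, F (x, t) - (F (x + y, t) + F (x - y, t)) / 2 - c * dotrv y y <= 0) ->
  - (2 * c) * dotrv h h <= 'D_(h, 0) ('D_(h, 0) F) (x, t).
Proof.
move=> sF Oxt hF.
have cD := symmetric_difference_cvg (v := (h, 0)) sF Oxt.
apply: (ler_cvg_to (cvg_cst _) cD).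
near=> r.
have r0 : 0 < r by near: r; exact: nbhs_right_gt.
have e1 : (x, t) + r *: (h, 0) = (x + r *: h, t).
  by congr (_, _); rewrite /= scaler0 addr0.
have e2 : (x, t) - r *: (h, 0) = (x - r *: h, t).
  by congr (_, _); rewrite /= scaler0 subr0.
have := hF (r *: h); rewrite /= e1 e2 dotrvZl dotrvZr => hr.
rewrite [leRHS]mulrC ler_pdivlMr ?exprn_gt0 //; lra.
Unshelve. all: by end_near. Qed.

Lemma open_slab (R : realType) (n : nat) : open [set p : 'rV[R]_n * R | 0 < p.2 < 1].
Proof.
have -> : [set p : 'rV[R]_n * R | 0 < p.2 < 1] = snd @^-1` `]0, 1[%classic.
  by apply/seteqP; split => p /=; rewrite in_itv.
by apply: open_comp; [move=> p _; exact: cvg_snd|exact: interval_open].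
Qed.

(** The constant depends neither on the points nor on how many there are, which is what allows N to
    be taken large. *)
Lemma slab_derivatives_bounded (R : realType) (n : nat) (O : set ('rV[R]_n * R))
    (F : 'rV[R]_n * R -> R) (v w : 'rV[R]_n * R) :
  smooth_in O F -> (forall x t, 0 <= t <= 1 -> O (x, t)) ->
  (forall t, 0 <= t <= 1 -> Zn_periodic (fun x => F (x, t))) ->
  exists C, forall x t, 0 < t < 1 -> `|'D_v ('D_w F) (x, t)| <= C.
Proof.
move=> sF O01 pF; have [oO dF] := sF.
pose S : set ('rV[R]_n * R) := [set p | 0 < p.2 < 1].
have oS : open S by exact: open_slab.
apply: (@periodic_bounded R n ('D_v ('D_w F)) [set t | 0 < t < 1]).
- by move=> t /= /andP[? ?]; rewrite !ltW.
- move=> x t t01; apply: differentiable_continuous.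
  exact: (dF [:: v; w] _ (O01 _ _ t01)).
move=> t t01 x k.
pose z : 'rV[R]_n * R := (map_mx intr k, 0).
have Fz p : S p -> F (p + z) = F p.
  case: p => y r /= /andP[r0 r1].
  have -> : (y, r) + z = (y + map_mx intr k, r) by congr (_, _); rewrite /= addr0.
  by apply: pF; rewrite !ltW.
have := derive_shift_in v oS (derive_shift_in w oS Fz) (p := (x, t)) t01.
by have -> : (x, t) + z = (x + map_mx intr k, t) by congr (_, _); rewrite /= addr0.
Qed.

Lemma hessian_bounded (R : realType) (n : nat) (O : set ('rV[R]_n * R))
    (F : 'rV[R]_n * R -> R) :
  smooth_in O F -> (forall x t, 0 <= t <= 1 -> O (x, t)) ->
  (forall t, 0 <= t <= 1 -> Zn_periodic (fun x => F (x, t))) ->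
  exists C, forall x t, 0 < t < 1 -> forall i j, `|hessian (@dx R n) F (x, t) i j| <= C.
Proof.
move=> sF O01 pF.
have /choice [C hC] : forall ij : 'I_n * 'I_n, exists C, forall x t, 0 < t < 1 ->
    `|'D_(dx R ij.1) ('D_(dx R ij.2) F) (x, t)| <= C.
  by move=> ij; exact: slab_derivatives_bounded sF O01 pF.
exists (\sum_ij `|C ij|) => x t t01 i j; rewrite mxE (bigD1 (i, j)) //=.
apply: (@le_trans _ _ `|C (i, j)|).
  by apply: le_trans (hC (i, j) x t t01) (ler_norm _).
by rewrite lerDl sumr_ge0.
Qed.

(** * Excluding a positive maximum for many points *)

Lemma form_add_scalar (R : realType) (n : nat) (A : 'M[R]_n) (h : 'rV[R]_n) (k : R) :
  (h *m (A + k%:M) *m h^T) 0 0 = (h *m A *m h^T) 0 0 + k * dotrv h h.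
Proof.
rewrite mulmxDr mulmxDl mul_mx_scalar -scalemxAl [LHS]mxE; congr (_ + _).
by rewrite [LHS]mxE.
Qed.

Lemma qform_scale0 (R : realType) (n : nat) (A : 'M[R]_n) (b h : 'rV[R]_n) (a k : R) :
  qform A b a (k *: h) 0 = k ^+ 2 * qform A b a h 0.
Proof.
rewrite /qform expr0n /= !mulr0 !mul0r !addr0 linearZ /= -!scalemxAl -scalemxAr scalerA.
by rewrite [LHS]mxE expr2.
Qed.

Lemma qform_at0 (R : realType) (n : nat) (A : 'M[R]_n) (b h : 'rV[R]_n) (a : R) :
  qform A b a h 0 = (h *m A *m h^T) 0 0.
Proof. by rewrite /qform expr0n /= !mulr0 mul0r !addr0. Qed.

Lemma qform_add_scalar (R : realType) (n : nat) (A : 'M[R]_n) (b h : 'rV[R]_n) (a k s : R) :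
  qform (A + k%:M) b a h s = qform A b a h s + k * dotrv h h.
Proof. by rewrite /qform form_add_scalar; ring. Qed.

Lemma donaldson_positive (R : realType) (a l b eps : R) :
  0 < eps -> 0 <= b -> 0 <= l -> a * l - b = eps -> 0 < a /\ 0 < l.
Proof.
move=> eps0 b0 l0 e; have al : 0 < a * l by lra.
have l1 : 0 < l.
  by rewrite lt_neqAle l0 andbT; apply: contraTneq al => <-; rewrite mulr0 ltxx.
by split=> //; rewrite -(pmulr_lgt0 _ l1).
Qed.

(* Varying a single point shows that the [A i] are nonnegative up to [O(1/N)];
   adding this defect to [A i] makes the concavity of [qform_mean_le_shift] applicable. *)
Lemma qform_mean_excess_le (R : realType) (n N : nat)
    (A : 'I_N.+1 -> 'M[R]_n) (b : 'I_N.+1 -> 'rV[R]_n) (a : 'I_N.+1 -> R)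
    (A0 : 'M[R]_n) (b0 : 'rV[R]_n) (a0 eps kap C1 C2 delta : R) :
  (0 < n)%N -> 0 < eps -> 0 < kap -> 0 < C1 -> 0 < C2 -> 0 < delta ->
  (forall i, (A i)^T = A i) ->
  (forall i, a i * (\tr (A i) + kap) - dotrv (b i) (b i) = eps) ->
  (forall i, a i <= C1) ->
  a0 * (\tr A0 + kap) - dotrv b0 b0 = eps -> 0 < \tr A0 + kap -> a0 <= C1 ->
  (forall h, - C2 * dotrv h h <= (h *m A0 *m h^T) 0 0) ->
  (forall (h : 'I_N.+1 -> 'rV[R]_n) (s : R),
    qform A0 b0 (a0 + delta) (meanv h) s <=
    meanr (fun i => qform (A i) (b i) (a i) (h i) s)) ->
  N.+1%:R * (delta * eps) <= 2 * C2 * n%:R * C1 ^+ 2.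
Proof.
move=> n0 eps0 kap0 C10 C20 delta0 As eqA aC eqA0 tau0 aC0 AC Q.
have n0R : 0 < n%:R :> R by rewrite ltr0n.
pose k : R := N.+1%:R^-1.
have k0 : 0 < k by rewrite invr_gt0 ltr0n.
(* Moving the point i alone by [h], with [s = 0], moves the mean by [k *: h]: thus k^2 A0 <= k (A i)
   as forms. *)
have Ai i h : - (k * C2) * dotrv h h <= (h *m A i *m h^T) 0 0.
  have := Q (fun j => if j == i then h else 0) 0.
  have -> : meanv (fun j => if j == i then h else 0) = k *: h.
    by rewrite /meanv -big_mkcond big_pred1_eq.
  have -> : meanr (fun j => qform (A j) (b j) (a j) (if j == i then h else 0) 0) =
      k * (h *m A i *m h^T) 0 0.
    rewrite /meanr (bigD1 i) //= eqxx qform_at0 big1 ?addr0 // => j /negPf ->.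
    by rewrite qform_at0 !mul0mx mxE.
  rewrite qform_scale0 qform_at0; have := AC h.
  move: ((h *m A0 *m _) 0 0) ((h *m A i *m _) 0 0) => E G hE.
  rewrite expr2 -mulrA ler_pM2l //; apply: le_trans.
  by rewrite -mulrN -mulrA ler_pM2l.
(* Twice the defect, so that [A' i] is strictly definite. *)
pose A' i := A i + (2 * k * C2)%:M.
have pA' i : pdmx (A' i).
  split; first by rewrite /A' raddfD /= tr_scalar_mx As.
  move=> h h0; rewrite /A' form_add_scalar.
  have := Ai i h; have : 0 < dotrv h h by rewrite dotrv_gt0.
  have : 0 < k * C2 by rewrite mulr_gt0.
  move: (dotrv h h) ((h *m A i *m _) 0 0) => D E; rewrite -(mulrA 2).
  by move: (k * C2) => m; nra.
(* The shift raises each trace by [2 * k * C2 * n%:R], at a cost of at most [C1] times this in the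
   equation. *)
pose eps' := eps + C1 * (2 * k * C2 * n%:R).
have kC : 0 < 2 * k * C2 * n%:R by rewrite !mulr_gt0.
have eps'0 : 0 < eps' by rewrite addr_gt0 // mulr_gt0.
have concl : (a0 + delta) * (\tr A0 + kap) <= eps' + dotrv b0 b0.
  apply: (@qform_mean_le_shift R n N A' b a) => //.
  - move=> i; rewrite /A' mxtraceD mxtrace_scalar addrAC -[_ *+ n]mulr_natl.
    rewrite /eps' [leLHS]mulrDr; have := eqA i; have := aC i.
    move: (dotrv _ _) (a i) (_ + kap) => D x y hx hy.
    have : x * (n%:R * (2 * k * C2)) <= C1 * (2 * k * C2 * n%:R).
      by rewrite [n%:R * _]mulrC ler_wpM2r // ltW.
    by lra.
  - move=> h s; apply: le_trans (Q h s) _; apply: le_meanr => i.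
    by rewrite qform_add_scalar lerDl mulr_ge0 ?dotrv_ge0 // ltW // !mulr_gt0.
(* Subtracting the exact equation at the mean point leaves only [delta * tau] on the left; the same
   equation bounds [tau] below by [eps / C1]. *)
move: (\tr A0 + kap) tau0 eqA0 concl => tau tau0 eqA0 concl.
have h1 : delta * tau <= C1 * (2 * k * C2 * n%:R).
  by move: concl; rewrite /eps' mulrDl; lra.
have h2 : eps <= C1 * tau.
  have : a0 * tau <= C1 * tau by rewrite ler_wpM2r // ltW.
  by have := dotrv_ge0 b0; lra.
have h3 : delta * eps <= 2 * C2 * n%:R * C1 ^+ 2 * k.
  have : delta * eps <= delta * (C1 * tau) by rewrite ler_pM2l.
  have : C1 * (delta * tau) <= C1 * (C1 * (2 * k * C2 * n%:R)) by rewrite ler_pM2l.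
  by lra.
by rewrite mulrC -ler_pdivlMr ?ltr0n.
Qed.

(** A positive maximum would be interior by the boundary assumption, and [qform_mean_excess_le] then
    bounds the number of points. The threshold [N0] is independent of the configuration. *)
Lemma gap_le0 (R : realType) (n : nat) (O : set ('rV[R]_n * R))
    (F : 'rV[R]_n * R -> R) (eps mu delta : R) :
  (0 < n)%N -> 0 < eps -> 0 < mu -> mu < 1 -> 0 < delta ->
  smooth_in O F -> (forall x t, 0 <= t <= 1 -> O (x, t)) ->
  (forall t, 0 <= t <= 1 -> Zn_periodic (fun x => F (x, t))) ->
  (forall x t, 0 < t < 1 -> donaldson F (x, t) = eps) ->
  (forall x t, 0 < t < 1 -> 0 <= n%:R + laplacian_x F (x, t)) ->
  (forall N (X : 'I_N.+1 -> 'rV[R]_n) t, t = 0 \/ t = 1 ->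
     F (meanv X, t) - meanr (fun i => F (X i, t)) - (1 - mu) / 2 * spread X <= 0) ->
  exists N0, forall N (X : 'I_N.+1 -> 'rV[R]_n) t, (N0 <= N)%N -> 0 <= t <= 1 ->
    gap F ((1 - mu) / 2) (delta / 2) X t <= 0.
Proof.
move=> n0 eps0 mu0 mu1 delta0 sF O01 pF eqF lapF bF.
have n0R : 0 < n%:R :> R by rewrite ltr0n.
have [Ca hCa] := slab_derivatives_bounded (dt R n) (dt R n) sF O01 pF.
have [Ch hCh] := hessian_bounded sF O01 pF.
pose H p := hessian (@dx R n) F p.
pose b p : 'rV[R]_n := \row_j 'D_(dt R n) ('D_(dx R j) F) p.
pose a p := 'D_(dt R n) ('D_(dt R n) F) p.
(* The x-Hessian of v - mu |x|^2 / 2; adding [kap] to its trace recovers n plus the Laplacian of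
   [F]. *)
pose A p := H p + (1 - mu)%:M.
pose tau p := n%:R + laplacian_x F p.
pose kap := n%:R * mu.
have kap0 : 0 < kap by rewrite mulr_gt0.
have trA p : \tr (A p) + kap = tau p.
  rewrite /A mxtraceD mxtrace_scalar -[_ *+ n]mulr_natl /kap /tau /laplacian_x.
  have -> : \tr (H p) = \sum_j 'D_(dx R j) ('D_(dx R j) F) p.
    by apply: eq_bigr => j _; rewrite mxE.
  by ring.
have eqn x t : 0 < t < 1 -> a (x, t) * tau (x, t) - dotrv (b (x, t)) (b (x, t)) = eps.
  move=> t01; rewrite -(eqF x t t01) /donaldson; congr (_ - _).
  by rewrite dotrvE; apply: eq_bigr => j _; rewrite !mxE expr2.
have pos x t : 0 < t < 1 -> 0 < a (x, t) /\ 0 < tau (x, t).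
  move=> t01; apply: (donaldson_positive eps0 (dotrv_ge0 _) (lapF x t t01)).
  exact: eqn.
pose C1 := `|Ca| + 1.
have C10 : 0 < C1 by rewrite ltr_wpDl.
have aC x t : 0 < t < 1 -> a (x, t) <= C1.
  move=> t01; apply: le_trans (ler_norm _) _; apply: le_trans (hCa x t t01) _.
  by apply: le_trans (ler_norm _) _; rewrite lerDl.
pose C2 := `|Ch| * n%:R + 1.
have C20 : 0 < C2 by rewrite ltr_wpDl // mulr_ge0.
have AC x t h : 0 < t < 1 -> - C2 * dotrv h h <= (h *m A (x, t) *m h^T) 0 0.
  move=> t01.
  have := form_lower_bound h (fun i j => le_trans (hCh x t t01 i j) (ler_norm Ch)).
  rewrite /A form_add_scalar; have := dotrv_ge0 h; rewrite /C2 -/(H _).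
  move: (dotrv h h) ((h *m H (x, t) *m h^T) 0 0) => D E; nra.
pose N0 := Num.bound (2 * C2 * n%:R * C1 ^+ 2 / (delta * eps)).
exists N0 => N X t N0N t01; rewrite leNgt; apply/negP => gX.
have c0 : 0 < (1 - mu) / 2 by rewrite divr_gt0 // subr_gt0.
have d0 : 0 <= delta / 2 by rewrite divr_ge0 // ltW.
have cF x r : 0 <= r <= 1 -> {for (x, r), continuous F}.
  move=> r01; apply: differentiable_continuous.
  exact: (sF.2 [::] _ (O01 _ _ r01)).
have [Y [r [r01 gY maxY]]] := gap_max c0 d0 cF pF t01 gX.
(* At t = 0 and t = 1 the term in [delta] vanishes, so [bF] contradicts positivity there. *)
have r01' : 0 < r < 1.
  case/andP: r01 => r0 r1; rewrite !lt_neqAle r0 r1 !andbT.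
  apply/andP; split; apply/eqP => er.
    have := bF N Y r (or_introl (esym er)); move: gY; rewrite /gap -er; lra.
  have := bF N Y r (or_intror er); move: gY; rewrite /gap er; lra.
have qF x h s : qform (A (x, r)) (b (x, r)) (a (x, r)) h s =
    'D_(h, s) ('D_(h, s) F) (x, r) + (1 - mu) * dotrv h h.
  by rewrite qform_add_scalar (qform_hessian h s sF (O01 x r r01)).
(* Since 2c = 1 - mu, the variance term of the second-order condition splits into exactly the
   multiples of the identity added to the Hessians in [A]. *)
have Q (h : 'I_N.+1 -> 'rV[R]_n) s :
    qform (A (meanv Y, r)) (b (meanv Y, r)) (a (meanv Y, r) + delta) (meanv h) s <=
    meanr (fun i => qform (A (Y i, r)) (b (Y i, r)) (a (Y i, r)) (h i) s).
  have -> : meanr (fun i => qform (A (Y i, r)) (b (Y i, r)) (a (Y i, r)) (h i) s) =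
      meanr (fun i => 'D_(h i, s) ('D_(h i, s) F) (Y i, r)) +
      (1 - mu) * meanr (fun i => dotrv (h i) (h i)).
    by rewrite -meanrZ -meanrD; apply: eq_meanr => i; rewrite qF.
  have -> : qform (A (meanv Y, r)) (b (meanv Y, r)) (a (meanv Y, r) + delta) (meanv h) s =
      qform (A (meanv Y, r)) (b (meanv Y, r)) (a (meanv Y, r)) (meanv h) s + delta * s ^+ 2.
    by rewrite /qform; ring.
  rewrite qF; have := gap_second_order h s sF O01 r01' maxY.
  by rewrite spreadE; lra.
have [a0 tau0] := pos (meanv Y) r r01'.
have h4 : N.+1%:R * (delta * eps) <= 2 * C2 * n%:R * C1 ^+ 2.
  apply: (@qform_mean_excess_le R n N (fun i => A (Y i, r)) (fun i => b (Y i, r))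
    (fun i => a (Y i, r)) (A (meanv Y, r)) (b (meanv Y, r)) (a (meanv Y, r)) eps kap) => //.
  - by move=> i; rewrite /A raddfD /= tr_scalar_mx (hessian_sym _ sF (O01 _ _ r01)).
  - by move=> i; rewrite trA eqn.
  - by move=> i; exact: aC.
  - by rewrite trA eqn.
  - by rewrite trA.
  - exact: aC.
  - by move=> h; exact: AC.
have : 2 * C2 * n%:R * C1 ^+ 2 / (delta * eps) < N.+1%:R.
  apply: lt_le_trans (archi_boundP _) _; last by rewrite ler_nat (leq_trans N0N).
  by rewrite divr_ge0 ?mulr_ge0 ?sqr_ge0 // ltW.
by rewrite ltr_pdivrMr ?mulr_gt0 // ltNge h4.
Qed.

(** * From the N-point inequality to the Hessian of the solution *)

Lemma hessian_ext (R : realType) (n : nat) (f g : 'rV[R]_n * R -> R) (p : 'rV[R]_n * R) :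
  (forall v w, 'D_v ('D_w f) p = 'D_v ('D_w g) p) ->
  hessian (@dx R n) f p = hessian (@dx R n) g p.
Proof.
by move=> fg; apply/matrixP => i j; rewrite [LHS]mxE [RHS]mxE; exact: fg.
Qed.

Lemma laplacian_x_ext (R : realType) (n : nat) (f g : 'rV[R]_n * R -> R)
    (p : 'rV[R]_n * R) :
  (forall v w, 'D_v ('D_w f) p = 'D_v ('D_w g) p) -> laplacian_x f p = laplacian_x g p.
Proof. by move=> fg; apply: eq_bigr => j _; exact: fg. Qed.

Lemma donaldson_ext (R : realType) (n : nat) (f g : 'rV[R]_n * R -> R)
    (p : 'rV[R]_n * R) :
  (forall v w, 'D_v ('D_w f) p = 'D_v ('D_w g) p) -> donaldson f p = donaldson g p.
Proof.
move=> fg; pose d (h : 'rV[R]_n * R -> R) (v w : 'rV[R]_n * R) : R := 'D_v ('D_w h) p.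
have dfg : d f = d g by apply/funext => v; apply/funext => w; exact: fg.
pose G (e : 'rV[R]_n * R -> 'rV[R]_n * R -> R) :=
  e (dt R n) (dt R n) * (n%:R + \sum_j e (dx R j) (dx R j)) -
  \sum_j e (dt R n) (dx R j) ^+ 2.
change (G (d f) = G (d g)).
by rewrite dfg.
Qed.

(* The estimate propagates from the boundary with its constant: if the Hessians
   of the boundary data are at least [mu] then so is that of the solution. *)
Lemma hessian_form_ge (R : realType) (n : nat) (O : set ('rV[R]_n * R))
    (F : 'rV[R]_n * R -> R) (eps mu : R) :
  (0 < n)%N -> 0 < eps -> 0 < mu -> mu < 1 ->
  smooth_in O F -> (forall x t, 0 <= t <= 1 -> O (x, t)) ->
  (forall t, 0 <= t <= 1 -> Zn_periodic (fun x => F (x, t))) ->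
  (forall x t, 0 < t < 1 -> donaldson F (x, t) = eps) ->
  (forall x t, 0 < t < 1 -> 0 <= n%:R + laplacian_x F (x, t)) ->
  (forall N (X : 'I_N.+1 -> 'rV[R]_n) t, t = 0 \/ t = 1 ->
     F (meanv X, t) - meanr (fun i => F (X i, t)) - (1 - mu) / 2 * spread X <= 0) ->
  forall x t (h : 'rV[R]_n), 0 < t < 1 ->
    mu * dotrv h h <= (h *m (hessian (@dx R n) F (x, t) + 1%:M) *m h^T) 0 0.
Proof.
move=> n0 eps0 mu0 mu1 sF O01 pF eqF lapF bF x t h t01.
have t01' : 0 <= t <= 1 by case/andP: t01 => ? ?; rewrite !ltW.
have Oxt := O01 x t t01'.
suff mid y : F (x, t) - (F (x + y, t) + F (x - y, t)) / 2 - (1 - mu) / 2 * dotrv y y <= 0.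
  have := second_derivative_ge h sF Oxt mid; rewrite -(qform_hessian h 0 sF Oxt).
  by rewrite /qform form_add_scalar expr0n /= !mulr0 mul0r; lra.
apply/ler_addgt0Pr => e e0; rewrite add0r.
(* With [delta = 2 * e] the last term of [gap] is [e * (t ^+ 2 - t)], which is at least [- e]. *)
have e20 : 0 < 2 * e by rewrite mulr_gt0.
have [N0 hN0] := gap_le0 n0 eps0 mu0 mu1 e20 sF O01 pF eqF lapF bF.
have N0le : (N0 <= N0.*2.+1)%N by rewrite -addnn ltnW // ltnS leq_addr.
have := hN0 _ (fun i : 'I_(N0.*2.+2) => if odd i then x + y else x - y) t N0le t01'.
rewrite gap_alternate; set G := _ - _ * dotrv y y.
by case/andP: t01 => ? ?; nra.
Qed.

(** The Hessian of [f] is at least [lambda - 1], hence at least [mu - 1]; this is Jensen's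
    inequality with [k = mu - 1]. *)
Lemma boundary_gap_le0 (R : realType) (n N : nat) (f : 'rV[R]_n -> R) (lambda mu : R)
    (X : 'I_N.+1 -> 'rV[R]_n) :
  smooth_in setT f -> mu <= lambda ->
  (forall x, mx_le lambda%:M (hessian (@ebase R n) f x + 1%:M)) ->
  f (meanv X) - meanr (fun i => f (X i)) - (1 - mu) / 2 * spread X <= 0.
Proof.
move=> sf ml hf.
have hD (y h : 'rV[R]_n) : (mu - 1) * dotrv h h <= 'D_h ('D_h f) y.
  have [_ /(_ h) +] := hf y.
  have -> : hessian (@ebase R n) f y + 1%:M - lambda%:M =
      hessian (@ebase R n) f y + (1 - lambda)%:M.
    by rewrite raddfB /= addrA.
  rewrite form_add_scalar (hessian_formE h sf I).
  have := dotrv_ge0 h; move: (dotrv h h) ('D_h _ y) => D E; nra.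
by have := jensen_spread X sf hD; lra.
Qed.

Lemma smooth_on_torus_in (R : realType) (n : nat) (f : 'rV[R]_n -> R) :
  smooth_on_torus f -> smooth_in setT f.
Proof.
move=> [_ [ O [F [oO sO dF Ff]]]].
have <- : F = f by apply/funext => x; exact: Ff.
split; first exact: openT.
by move=> vs p _; apply: dF; exact: sO.
Qed.

Unset Implicit Arguments.
Set Strict Implicit.
Set Printing Implicit Defensive.
Local Close Scope classical_set_scope.

Theorem theorem4 (R : realType) (n : nat) (hn : n \in [:: 1; 2; 3]%N)
  (eps lambda : R) (heps : 0 < eps) (hlambda : 0 < lambda)
  (u0 u1 : 'rV[R]_n -> R)
  (hu0 : smooth_on_torus u0) (hu1 : smooth_on_torus u1)
  (hess_u0 : forall x : 'rV[R]_n, mx_le lambda%:M (hessian (@ebase R n) u0 x + 1%:M))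
  (hess_u1 : forall x : 'rV[R]_n, mx_le lambda%:M (hessian (@ebase R n) u1 x + 1%:M))
  (u : 'rV[R]_n * R -> R) (hu : smooth_on_torus_segment u)
  (equ : forall (x : 'rV[R]_n) (t : R), 0 < t < 1 -> donaldson u (x, t) = eps)
  (lap_u : forall (x : 'rV[R]_n) (t : R), 0 < t < 1 -> 0 <= n%:R + laplacian_x u (x, t))
  (bdry0 : forall x : 'rV[R]_n, u (x, 0) = u0 x)
  (bdry1 : forall x : 'rV[R]_n, u (x, 1) = u1 x) :
  forall (x : 'rV[R]_n) (t : R), 0 < t < 1 -> mx_lt 0 (hessian (@dx R n) u (x, t) + 1%:M).
Proof.
have n0 : (0 < n)%N by move: hn; rewrite !inE => /or3P[] /eqP ->.
have [pu [ O [F [oO sO dF Fu]]]] := hu.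
have sF : smooth_in O F by [].
have O01 x t : 0 <= t <= 1 -> O (x, t) by move=> t01; exact: sO.
have FuE x t : 0 <= t <= 1 -> F (x, t) = u (x, t) by move=> t01; exact: Fu.
have uFE (p : 'rV[R]_n * R) : 0 < p.2 < 1 -> u p = F p.
  by case: p => y r /= /andP[r0 r1]; rewrite FuE // !ltW.
(* Equality of functions on the open slab passes to derivatives there; at the end times [u] and [F]
   need not agree on both sides. *)
have D1E w (p : 'rV[R]_n * R) : 0 < p.2 < 1 -> 'D_w u p = 'D_w F p.
  exact: (derive_eq_in w (@open_slab R n) uFE).
have DuE v w (p : 'rV[R]_n * R) : 0 < p.2 < 1 -> 'D_v ('D_w u) p = 'D_v ('D_w F) p.
  exact: (derive_eq_in v (@open_slab R n) (D1E w)).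
have hessE p (p01 : 0 < p.2 < 1) := hessian_ext (fun v w => DuE v w p p01).
have lapE p (p01 : 0 < p.2 < 1) := laplacian_x_ext (fun v w => DuE v w p p01).
have donE p (p01 : 0 < p.2 < 1) := donaldson_ext (fun v w => DuE v w p p01).
(* Capping by 1/2 ensures [mu < 1], so the variance enters [gap] with a positive coefficient and
   makes it coercive. *)
pose mu := Num.min lambda (1 / 2).
have mu0 : 0 < mu by rewrite lt_min hlambda divr_gt0.
have mu1 : mu < 1 by rewrite gt_min; apply/orP; right; lra.
have ml : mu <= lambda by rewrite ge_min lexx.
have bF N (X : 'I_N.+1 -> 'rV[R]_n) t : t = 0 \/ t = 1 ->
    F (meanv X, t) - meanr (fun i => F (X i, t)) - (1 - mu) / 2 * spread X <= 0.
  have F0 x : F (x, 0) = u0 x by rewrite FuE ?bdry0 // lexx ler01.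
  have F1 x : F (x, 1) = u1 x by rewrite FuE ?bdry1 // lexx ler01.
  case=> ->.
    rewrite F0 (eq_meanr (fun i => F0 (X i))).
    exact: boundary_gap_le0 (smooth_on_torus_in hu0) ml hess_u0.
  rewrite F1 (eq_meanr (fun i => F1 (X i))).
  exact: boundary_gap_le0 (smooth_on_torus_in hu1) ml hess_u1.
have pF t : 0 <= t <= 1 -> Zn_periodic (fun x => F (x, t)).
  by move=> t01 x k; rewrite !FuE //; exact: pu.
move=> x t t01; have t01' : 0 <= t <= 1 by case/andP: t01 => ? ?; rewrite !ltW.
rewrite hessE // /mx_lt subr0; split.
  by rewrite raddfD /= tr_scalar_mx (hessian_sym _ sF (O01 x t t01')).
move=> h h0; apply: lt_le_trans (hessian_form_ge n0 heps mu0 mu1 sF O01 pF _ _ bF x h t01).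
- by rewrite mulr_gt0 // dotrv_gt0.
- by move=> y r r01; rewrite -donE // equ.
- by move=> y r r01; rewrite -lapE // lap_u.
Qed.
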